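(* Let $R$ be a ring with enough idempotents. Let $\mathcal B$ be a precovering class of modules closed under direct summands, and let $\mathcal F$ be a class of finitely presented modules closed under finite direct sums. Assume that $\mathcal B$ contains a generator (of $\mathrm{Mod}\text{-}R$), and that there exists an infinite cardinal $\theta$ such that $\mathcal S_\theta\cap\varinjlim\mathcal F\subseteq\mathcal B$. Then $\mathcal B$ contains all $\theta$-presented modules from $\varinjlim\mathcal F$.
   Context: $R$ is an associative ring with enough idempotents. ''Module'' means unitary right $R$-module ($M=MR$); $\mathrm{Mod}\text{-}R$ is the category of all modules. A module $M$ is finitely presented if $\mathrm{Hom}_R(M,-)$ commutes with direct limits. For an infinite cardinal $\theta$, a module is $\theta$-presented (resp. $<\theta$-presented) if it is the direct limit of a direct system of cardinality $\leq\theta$ (resp. $<\theta$) consisting of finitely presented modules. A module $M$ is finitely $\theta$-separable if it is the directed union of a system consisting of $<\theta$-presented direct summands of $M$; $\mathcal S_\theta$ denotes the class of all finitely $\theta$-separable modules. $\varinjlim\mathcal F$ denotes the class of all modules that are direct limits of direct systems of modules from $\mathcal F$. A class $\mathcal B$ of modules is precovering if for every $M\in\mathrm{Mod}\text{-}R$ there exist $B\in\mathcal B$ and $f\in\mathrm{Hom}_R(B,M)$ such that for every $B'\in\mathcal B$ the map $\mathrm{Hom}_R(B',f):\mathrm{Hom}_R(B',B)\to\mathrm{Hom}_R(B',M)$ is surjective. *)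

(* Defs.v *)
From HB Require Import structures.
From mathcomp Require Import all_boot all_order all_algebra.
From mathcomp Require Import boolp classical_sets functions cardinality fsbigop.

Set Implicit Arguments.
Unset Strict Implicit.
Unset Printing Implicit Defensive.

Import Order.TTheory GRing.Theory.

Local Open Scope classical_set_scope.
Local Open Scope card_scope.
Local Open Scope ring_scope.

(* Associative rings, not assumed to be unital nor commutative. *)
HB.mixin Record Zmodule_isRng R of GRing.Zmodule R := {
  rngmul : R -> R -> R;
  rngmulA : associative rngmul;
  rngmulDl : left_distributive rngmul +%R;
  rngmulDr : right_distributive rngmul +%R
}.

#[short(type="rngType")]
HB.structure Definition Rng := {R of Zmodule_isRng R & GRing.Zmodule R}.

(* X is the internal direct sum of its subsets A i. *)
Definition internal_direct_sum (I : choiceType) (X : zmodType)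
    (A : I -> set X) : Prop :=
  forall x : X, exists! c : I -> X,
    [/\ forall i, A i (c i),
        finite_set [set i | c i != 0] &
        x = \sum_(i \in [set: I]) c i].

Definition enough_idempotents (R : rngType) : Prop :=
  exists (I : choiceType) (e : I -> R),
    [/\ forall i, rngmul (e i) (e i) = e i,
        forall i j, i != j -> rngmul (e i) (e j) = 0,
        internal_direct_sum (fun i => [set rngmul (e i) r | r in [set: R]]) &
        internal_direct_sum (fun i => [set rngmul r (e i) | r in [set: R]])].

(* The last axiom is M = MR: every element is a finite sum of elements m r. *)
HB.mixin Record Zmodule_isRModule (R : rngType) M of GRing.Zmodule M := {
  ract : M -> R -> M;
  ractA : forall m r s, ract m (rngmul r s) = ract (ract m r) s;
  ractDl : forall m n r, ract (m + n) r = ract m r + ract n r;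
  ractDr : forall m r s, ract m (r + s) = ract m r + ract m s;
  ract_unitary : forall m, exists s : seq (M * R),
    m = \sum_(p <- s) ract p.1 p.2
}.

#[short(type="rmodType")]
HB.structure Definition RModule (R : rngType) :=
  {M of Zmodule_isRModule R M & GRing.Zmodule M}.

Section Hom.
Context {R : rngType}.
Implicit Types M N P : rmodType R.

Definition is_rhom M N (f : M -> N) : Prop :=
  zmod_morphism f /\ forall m r, f (ract m r) = ract (f m) r.

Definition rhom_pred M N : {pred M -> N} := fun f => `[< is_rhom f >].

Lemma rhom_zmod_closed M N : zmod_closed (@rhom_pred M N).
Proof.
split=> [|f g /asboolP[fB fr] /asboolP[gB gr]]; apply/asboolP; split.
- by move=> x y; rewrite /= subr0.
- move=> m r; change (0 = ract (0 : N) r).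
  by apply: (addIr (ract 0 r)); rewrite -ractDl !add0r.
- move=> x y; change (f (x - y) - g (x - y) = f x - g x - (f y - g y)).
  by rewrite fB gB !opprD !opprK addrACA.
- move=> m r; change (f (ract m r) - g (ract m r) = ract (f m - g m) r).
  by rewrite fr gr; apply: (addIr (ract (g m) r)); rewrite subrK -ractDl subrK.
Qed.

HB.instance Definition _ M N :=
  GRing.isZmodClosed.Build (M -> N) (@rhom_pred M N) (@rhom_zmod_closed M N).

Record rhom M N :=
  RHom { rhom_fun :> M -> N; rhom_subproof : rhom_fun \in @rhom_pred M N }.

HB.instance Definition _ M N := [isSub for @rhom_fun M N].
HB.instance Definition _ M N := [Choice of rhom M N by <:].
HB.instance Definition _ M N := [SubChoice_isSubZmodule of rhom M N by <:].

Lemma rhomP M N (f : rhom M N) : is_rhom f.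
Proof. exact: (asboolW (rhom_subproof f)). Qed.

Lemma comp_is_rhom M N P (g : rhom N P) (f : rhom M N) : is_rhom (g \o f).
Proof.
have [gB gr] := rhomP g; have [fB fr] := rhomP f.
by split=> [x y|m r]; rewrite /= ?fB ?gB ?fr ?gr.
Qed.

Definition rhom_comp M N P (g : rhom N P) (f : rhom M N) : rhom M P :=
  RHom (asboolT (comp_is_rhom g f)).

End Hom.

Record direct_system (R : rngType) := DirectSystem {
  ds_disp : Order.disp_t;
  ds_idx : porderType ds_disp;
  ds_inhabited : inhabited ds_idx;
  ds_directed : forall i j : ds_idx, exists k, (i <= k)%O /\ (j <= k)%O;
  ds_obj :> ds_idx -> rmodType R;
  ds_map : forall i j, (i <= j)%O -> rhom (ds_obj i) (ds_obj j);
  ds_map_id : forall i (ii : (i <= i)%O) x, ds_map ii x = x;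
  ds_map_comp : forall i j k (ij : (i <= j)%O) (jk : (j <= k)%O)
    (ik : (i <= k)%O) x, ds_map jk (ds_map ij x) = ds_map ik x
}.

(* (L, u) is the colimit, in the category of unitary right R-modules, of D. *)
Definition is_direct_limit (R : rngType) (D : direct_system R) (L : rmodType R)
    (u : forall i, rhom (D i) L) : Prop :=
  (forall i j (ij : (i <= j)%O), rhom_comp (u j) (ds_map ij) = u i) /\
  forall (N : rmodType R) (v : forall i, rhom (D i) N),
    (forall i j (ij : (i <= j)%O), rhom_comp (v j) (ds_map ij) = v i) ->
    exists! h : rhom L N, forall i, rhom_comp h (u i) = v i.

(* (L, u) is the colimit, in the category of abelian groups, of (A, a). *)
Definition is_direct_limit_ab (d : Order.disp_t) (I : porderType d)
    (A : I -> zmodType) (a : forall i j, (i <= j)%O -> A i -> A j)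
    (L : zmodType) (u : forall i, A i -> L) : Prop :=
  [/\ forall i, zmod_morphism (u i),
      forall i j (ij : (i <= j)%O), u j \o a i j ij = u i &
      forall (B : zmodType) (v : forall i, A i -> B),
        (forall i, zmod_morphism (v i)) ->
        (forall i j (ij : (i <= j)%O), v j \o a i j ij = v i) ->
        exists! h : L -> B, zmod_morphism h /\ forall i, h \o u i = v i].

(* Hom_R(M, -), as a functor to abelian groups, commutes with direct limits. *)
Definition finitely_presented (R : rngType) (M : rmodType R) : Prop :=
  forall (D : direct_system R) (L : rmodType R) (u : forall i, rhom (D i) L),
    is_direct_limit u ->
    @is_direct_limit_ab _ (ds_idx D) (fun i => rhom M (D i))
      (fun i j ij => rhom_comp (ds_map ij)) (rhom M L) (fun i => rhom_comp (u i)).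

(* A cardinal theta is represented by a type T of that cardinality. *)
Definition presented (R : rngType) (T : Type) (M : rmodType R) : Prop :=
  exists D : direct_system R,
    [/\ [set: ds_idx D] #<= [set: T],
        forall i, finitely_presented (D i) &
        exists u : forall i, rhom (D i) M, is_direct_limit u].

Definition lt_presented (R : rngType) (T : Type) (M : rmodType R) : Prop :=
  exists D : direct_system R,
    [/\ [set: ds_idx D] #<= [set: T] /\ ~ ([set: T] #<= [set: ds_idx D]),
        forall i, finitely_presented (D i) &
        exists u : forall i, rhom (D i) M, is_direct_limit u].

Section Classes.
Context {R : rngType}.
Implicit Types (B F : rmodType R -> Prop) (M N : rmodType R).

Definition lim_class F M : Prop :=
  exists D : direct_system R,
    (forall i, F (D i)) /\
    exists u : forall i, rhom (D i) M, is_direct_limit u.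

(* N is the direct sum of X and some module Y, i : X -> N being the
   corresponding embedding. *)
Definition summand_embedding (X N : rmodType R) (i : rhom X N) : Prop :=
  exists (Y : rmodType R) (j : rhom Y N),
    forall z : N, exists! p : X * Y, z = i p.1 + j p.2.

Definition closed_summands B : Prop :=
  forall X N (i : rhom X N), B N -> summand_embedding i -> B X.

Definition closed_finite_sums F : Prop :=
  forall (n : nat) (X : 'I_n -> rmodType R) (N : rmodType R)
    (j : forall k, rhom (X k) N),
    (forall k, F (X k)) ->
    (forall z : N, exists! x : (forall k, X k), z = \sum_(k < n) j k (x k)) ->
    F N.

(* M is the union of a directed set S of submodules, each of which is a
   direct summand of M and < theta-presented. *)
Definition separable (T : Type) M : Prop :=
  exists S : set (set M),
    [/\ S !=set0,
        forall A A', S A -> S A' -> exists2 C, S C & A `|` A' `<=` C,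
        \bigcup_(A in S) A = [set: M] &
        forall A, S A -> exists (X : rmodType R) (i : rhom X M),
          [/\ lt_presented T X, summand_embedding i & A = range i]].

(* G is a generator of the category: Hom_R(G, -) is faithful. *)
Definition is_generator (G : rmodType R) : Prop :=
  forall M N (f g : rhom M N),
    (forall h : rhom G M, rhom_comp f h = rhom_comp g h) -> f = g.

Definition precovering B : Prop :=
  forall M, exists (X : rmodType R) (f : rhom X M),
    B X /\ forall X' : rmodType R, B X' ->
      forall g : rhom X' M, exists h : rhom X' X, rhom_comp f h = g.

End Classes.

(* Main.v *)
Require Import Defs.
From HB Require Import structures.
From mathcomp Require Import all_boot all_order all_algebra.
From mathcomp Require Import boolp classical_sets functions cardinality.
From mathcomp Require Import fsbigop wochoice.

(** The module M is shown to be a direct summand of N in B, where f : N -> M is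
    a B-precover; for this it suffices to split f.

    By [presented_chain] and [chain_colim], M is the direct limit of a chain,
    indexed by a well-order W, of modules A b, each being the direct limit of
    fewer than theta modules from F. This combines the two given presentations of M, and
    uses that an infinite set is equipotent to its square ([emb_square]) to close
    small sets of indices under choices.

    Over any tree of height W there is the module L of step functions
    ([tree_all]): it is generated, inside the functions sending each node of
    level b to an element of A b, by the functions [nu x b y] that follow an
    element y of A b along a branch x from level b on. The step functions with a
    given finite set E of branches and a given finite set S of levels form a
    finite direct sum of modules A b ([step_basis]), a direct summand of L
    ([tree_mod_summand]), and a direct limit of fewer than theta finite direct
    sums of modules from F ([tree_limit], [tree_idx_small]). Hence L is
    separable; the same direct limit argument applied to all pairs E, S at once
    shows that L is a direct limit of modules from F. So L lies in B, and every
    homomorphism from L to M lifts along f.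

    For each set g of branches there is a homomorphism L -> M that adds up the
    eventual values of a step function along the branches in g ([branch_sum]).
    Choose lifts h g : L -> N. The differences between following y from level a
    and following the image of y from level b depend on the part of the branch
    below b only, so the values of h g on them form a family indexed by the
    nodes. The labels of the tree are chosen by recursion on the level so that
    each such family is coded by one branch ([exists_coding_tree]). As there are
    more sets of branches than branches, two distinct g and g' give the same
    family; then h g - h g' vanishes on these differences, and on a branch that
    belongs to only one of g and g' it induces a map M -> N which is, up to sign,
    a section of f ([lifting_splits]). *)

Set Implicit Arguments.
Unset Strict Implicit.
Unset Printing Implicit Defensive.

Import Order.TTheory GRing.Theory.

Local Open Scope classical_set_scope.

(** * Cardinals *)

Lemma sval_inj T (P : T -> Prop) : injective (@proj1_sig T P).
Proof. by move=> [x Px] [y Py] /= xy; apply: eq_exist. Qed.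

(** The cardinality of X is at most that of Y. *)
Definition emb (X Y : Type) : Prop := exists f : X -> Y, injective f.

Lemma card_le_emb (X Y : Type) : ([set: X] #<= [set: Y])%card <-> emb X Y.
Proof.
split=> [/card_leP[f]|[f fI]].
- have inT (Z : Type) (z : Z) : z \in [set: Z] by rewrite inE.
  exists (fun x => val (f (SigSub (inT X x)))) => x y /val_inj fxy.
  have := 'inj_f (in_setT (SigSub (inT X x))) (in_setT (SigSub (inT X y))) fxy.
  by move=> [].
- have /injfunPex[g] : exists2 g : X -> Y, set_fun setT setT g & set_inj setT g.
    by exists f => // x y _ _ /fI.
  exact: inj_card_le.
Qed.

Lemma emb_refl X : emb X X. Proof. by exists id. Qed.

Lemma emb_trans Y X Z : emb X Y -> emb Y Z -> emb X Z.
Proof. by move=> [f fI] [g gI]; exists (g \o f); apply: inj_comp. Qed.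

Lemma emb_sig X (A : X -> Prop) : emb {x | A x} X.
Proof. by exists (@proj1_sig _ _); exact: sval_inj. Qed.

Lemma emb_prod X X' Y Y' : emb X X' -> emb Y Y' -> emb (X * Y) (X' * Y').
Proof.
move=> [f fI] [g gI]; exists (fun p => (f p.1, g p.2)).
by move=> [x y] [x' y'] [/fI -> /gI ->].
Qed.

Lemma emb_sum X X' Y Y' : emb X X' -> emb Y Y' -> emb (X + Y) (X' + Y').
Proof.
move=> [f fI] [g gI].
exists (fun p => match p with inl x => inl (f x) | inr y => inr (g y) end).
by move=> [x|y] [x'|y'] // [] => [/fI|/gI] ->.
Qed.

(** The image of a map embeds into its domain. *)
Lemma emb_range X Y (f : X -> Y) : emb {y | range f y} X.
Proof.
have h (z : {y | range f y}) : exists x, f x = sval z.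
  by case: z => y [x rx xy]; exists x.
exists (fun z => sval (cid (h z))) => z z' e.
by apply: sval_inj; rewrite -(svalP (cid (h z))) e (svalP (cid (h z'))).
Qed.

Lemma emb_total X Y : emb X Y \/ emb Y X.
Proof.
pose P (G : set (X * Y)) := forall p q, G p -> G q -> p.1 = q.1 <-> p.2 = q.2.
have [F FP Ftot|G [PG maxG]] := @Zorn_bigcup (X * Y)%type P.
  move=> p q [A FA Ap] [B FB Bq].
  by have [AB|BA] := Ftot _ _ FA FB; [apply: (FP _ FB); first exact: AB
    |apply: (FP _ FA); last exact: BA].
have [domG|] := pselect (forall x, exists y, G (x, y)).
  left; exists (fun x => sval (cid (domG x))) => x x' e.
  exact: (PG _ _ (svalP (cid (domG x))) (svalP (cid (domG x')))).2.
have [ranG _|] := pselect (forall y, exists x, G (x, y)).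
  right; exists (fun y => sval (cid (ranG y))) => y y' e.
  exact: (PG _ _ (svalP (cid (ranG y))) (svalP (cid (ranG y')))).1.
move=> /existsNP[y ny] /existsNP[x nx]; exfalso.
apply: (maxG (G `|` [set (x, y)])).
  rewrite properEneq; split; last by left.
  by apply/eqP => GE; apply: nx; exists y; rewrite GE; right.
move=> p q [Gp|->] [Gq|->] //=; first exact: PG.
- case: p Gp => a b /= Gp; split=> e; exfalso.
    by apply: nx; exists b; rewrite -e.
  by apply: ny; exists a; rewrite -e.
- case: q Gq => a b /= Gq; split=> e; exfalso.
    by apply: nx; exists b; rewrite e.
  by apply: ny; exists a; rewrite e.
Qed.

Lemma emb_sum_self X : emb nat X -> emb (X * X) X -> emb (X + X) X.
Proof.
move=> [n nI] XX; apply: emb_trans XX.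
exists (fun p => match p with inl x => (x, n 0) | inr x => (x, n 1) end).
by move=> [x|x] [y|y] // [] => [->|-> /nI|-> /nI|->].
Qed.

Lemma emb_split X (A : set X) : emb X ({x | A x} + {x | ~ A x}).
Proof.
exists (fun x => match pselect (A x) with
  | left h => inl (exist _ x h) | right h => inr (exist _ x h) end).
move=> x y; case: pselect => hx; case: pselect => hy //.
  by move=> [].
by move=> [].
Qed.

(** An infinite type is equipotent to its square. *)
Lemma emb_square X : emb nat X -> emb (X * X) X.
Proof.
move=> [n nI].
(* Zorn's lemma, for infinite subsets of X together with an injective pairing
   function on them, ordered by extension. *)
pose good (p : set X * (X -> X -> X)) :=
  [/\ forall k, p.1 (n k), forall x y, p.1 x -> p.1 y -> p.1 (p.2 x y) &
      forall x y x' y', p.1 x -> p.1 y -> p.1 x' -> p.1 y' ->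
        p.2 x y = p.2 x' y' -> x = x' /\ y = y'].
pose R (p q : {p | good p}) := `[< (sval p).1 `<=` (sval q).1 /\
  forall x y, (sval p).1 x -> (sval p).1 y -> (sval p).2 x y = (sval q).2 x y >].
have [p0] : inhabited {p | good p}.
  have [c cI] : emb (nat * nat) nat.
    by apply/card_le_emb; have := card_nat2; rewrite card_eq_le => /andP[].
  have [m mE] : exists m : X -> nat, forall k, m (n k) = k.
    have h x : exists k, (exists k', n k' = x) -> n k = x.
      by have [[k kx]|no] := pselect (exists k, n k = x); [exists k|exists 0].
    exists (fun x => sval (cid (h x))) => k; apply: nI.
    by apply: (svalP (cid (h (n k)))); exists k.
  constructor; exists (range n, fun x y => n (c (m x, m y))); split=> /=.
  - by move=> k; exists k.
  - by move=> x y _ _; exists (c (m x, m y)).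
  - move=> _ _ _ _ [x _ <-] [y _ <-] [x' _ <-] [y' _ <-].
    by rewrite !mE => /nI /cI [-> ->].
have Rrefl p : R p p by apply/asboolP; split.
have Rtr q p r : R p q -> R q r -> R p r.
  move=> /asboolP[pq pqf] /asboolP[qr qrf]; apply/asboolP.
  split=> [x /pq/qr //|x y px py]; rewrite pqf// qrf//; exact: pq.
have [F Ftot|[[A f] [/= nA fA fI]] maxp] := ZL_preorder p0 Rrefl (fun q p r => @Rtr p q r).
  have [[q0 Fq0]|F0] := pselect (exists q, F q); last by exists p0 => q Fq; case: F0; exists q.
  pose U x := exists2 q, F q & (sval q).1 x.
  have U2 x y : U x -> U y -> exists2 q, F q & (sval q).1 x /\ (sval q).1 y.
    move=> [q Fq qx] [r Fr ry]; have [/asboolP[qr _]|/asboolP[rq _]] := Ftot _ _ Fq Fr.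
      by exists r => //; split=> //; exact: qr.
    by exists q => //; split=> //; exact: rq.
  have hf x y : exists z, forall q, F q -> (sval q).1 x -> (sval q).1 y -> z = (sval q).2 x y.
    have [[q Fq [qx qy]]|no] := pselect (exists2 q, F q & (sval q).1 x /\ (sval q).1 y).
      exists ((sval q).2 x y) => r Fr rx ry.
      by have [/asboolP[_ ->]|/asboolP[_ ->]] := Ftot _ _ Fq Fr.
    by exists x => q Fq qx qy; case: no; exists q.
  pose f x y := sval (cid (hf x y)).
  have fE x y q : F q -> (sval q).1 x -> (sval q).1 y -> f x y = (sval q).2 x y.
    exact: (svalP (cid (hf x y))).
  have gU : good (U, f).
    split=> /=.
    - by move=> k; exists q0 => //; case: (svalP q0).
    - move=> x y Ux Uy; have [q Fq [qx qy]] := U2 _ _ Ux Uy.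
      by exists q => //; rewrite (fE _ _ q)//; case: (svalP q) => _ + _; apply.
    - move=> x y x' y' Ux Uy Ux' Uy'.
      have [q Fq [qx qy]] := U2 _ _ Ux Uy; have [r Fr [rx ry]] := U2 _ _ Ux' Uy'.
      have [s Fs [sxy sx'y']] : exists2 s, F s & ((sval s).1 x /\ (sval s).1 y) /\
          ((sval s).1 x' /\ (sval s).1 y').
        have [/asboolP[qr _]|/asboolP[rq _]] := Ftot _ _ Fq Fr.
          by exists r => //; do !split=> //; exact: qr.
        by exists q => //; do !split=> //; exact: rq.
      case: sxy sx'y' => sx sy [sx' sy'].
      rewrite !(fE _ _ s)//; case: (svalP s) => _ _; exact.
  exists (exist _ (U, f) gU) => q Fq; apply/asboolP; split=> /= [x qx|x y qx qy]; first by exists q.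
  by rewrite (fE _ _ q).
pose SA := {x | A x}.
have nSA : emb nat SA.
  by exists (fun k => exist _ (n k) (nA k)) => k l [] /nI.
have SA2 : emb (SA * SA) SA.
  exists (fun p => exist _ _ (fA _ _ (svalP p.1) (svalP p.2))).
  move=> [[x hx] [y hy]] [[x' hx'] [y' hy']] [] /= /fI[]// ? ?; subst.
  by congr (_, _); apply: eq_exist.
have SAA := emb_sum_self nSA SA2.
have [nSA_SA|[g gI]] := emb_total {x | ~ A x} SA.
  have XA : emb X SA.
    apply: emb_trans SAA; apply: emb_trans (emb_split A) _.
    exact: emb_sum (emb_refl _) nSA_SA.
  apply: emb_trans (emb_prod XA XA) _; apply: emb_trans SA2 (emb_sig _).
exfalso.
(* A disjoint copy of A inside its complement lets the pairing be extended to
   the union of A and of that copy. *)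
pose A' x := A x \/ exists a : SA, sval (g a) = x.
have [e eI] : emb ({x | A' x} * {x | A' x}) SA.
  apply: emb_trans SA2.
  have XA : emb {x | A' x} SA.
    apply: emb_trans SAA.
    have h (z : {x | A' x}) : exists w : SA + SA,
        match w with inl a => sval a = sval z | inr a => sval (g a) = sval z end.
      by case: z => x [Ax|[a ax]] /=; [exists (inl (exist _ x Ax))|exists (inr a)].
    exists (fun z => sval (cid (h z))) => z z' ezz'; apply: sval_inj.
    by move: (svalP (cid (h z))) (svalP (cid (h z'))); rewrite ezz'; case: (sval _) => ? -> ->.
  exact: emb_prod.
pose f' x y := match pselect (A x /\ A y), pselect (A' x), pselect (A' y) with
  | left _, _, _ => f x y
  | right _, left hx, left hy => sval (g (e (exist _ x hx, exist _ y hy)))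
  | _, _, _ => x end.
have f'1 x y : A x -> A y -> f' x y = f x y by move=> Ax Ay; rewrite /f'; case: pselect => // -[].
have f'2 x y (hx : A' x) (hy : A' y) : ~ (A x /\ A y) ->
    f' x y = sval (g (e (exist _ x hx, exist _ y hy))).
  move=> nxy; rewrite /f'; case: pselect => // ?; case: pselect => // h; case: pselect => // h'.
  by rewrite (Prop_irrelevance h hx) (Prop_irrelevance h' hy).
have g' : good (A', f').
  split=> /=.
  - by move=> k; left.
  - move=> x y A'x A'y; have [[Ax Ay]|n1] := pselect (A x /\ A y).
      by left; rewrite f'1//; exact (fA _ _ Ax Ay).
    by right; rewrite (f'2 _ _ A'x A'y n1); eexists.
  - move=> x y x' y' A'x A'y A'x' A'y'.
    have [[Ax Ay]|n1] := pselect (A x /\ A y); have [[Ax' Ay']|n2] := pselect (A x' /\ A y').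
    + rewrite !f'1//; exact (fI _ _ _ _ Ax Ay Ax' Ay').
    + rewrite f'1// (f'2 _ _ A'x' A'y' n2) => E; exfalso.
      apply: (svalP (g (e (exist _ x' A'x', exist _ y' A'y')))).
      by rewrite -E; exact (fA _ _ Ax Ay).
    + rewrite (f'1 x') // (f'2 _ _ A'x A'y n1) => E; exfalso.
      apply: (svalP (g (e (exist _ x A'x, exist _ y A'y)))).
      by rewrite E; exact (fA _ _ Ax' Ay').
    + by rewrite (f'2 _ _ A'x A'y n1) (f'2 _ _ A'x' A'y' n2) => /sval_inj/gI/eI [].
have Rp' : R (exist _ (A, f) (And3 nA fA fI)) (exist _ (A', f') g').
  apply/asboolP; split=> /= [x|x y Ax Ay]; first by left.
  by rewrite f'1.
have /asboolP[/= sub _] := maxp _ Rp'.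
have a0 : SA by exists (n 0); exact (nA 0).
by apply: (svalP (g a0)); apply: sub; right; exists a0.
Qed.

Lemma not_emb_nat_prod X Y : ~ emb nat X -> ~ emb nat Y -> ~ emb nat (X * Y).
Proof.
rewrite -!card_le_emb -!finite_setPn => fX fY.
by rewrite -setXTT; exact: finite_setX.
Qed.

(** The cardinality of X is smaller than that of theta. *)
Definition small (theta X : Type) : Prop := emb X theta /\ ~ emb theta X.

Section Small.
Variable theta : Type.
Hypothesis theta_inf : emb nat theta.

Lemma small_emb X Y : emb X Y -> small theta Y -> small theta X.
Proof.
by move=> XY [Yt tY]; split; [exact: emb_trans Yt|move=> /emb_trans/(_ XY)].
Qed.

Lemma finite_small X : ~ emb nat X -> small theta X.
Proof.
move=> Xfin; have tX : ~ emb theta X by move=> /(emb_trans theta_inf).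
by split=> //; have [] := emb_total X theta.
Qed.

Lemma small_prod X Y : small theta X -> small theta Y -> small theta (X * Y).
Proof.
have sq Z : small theta Z -> small theta (Z * Z).
  move=> sZ; have [Zinf|Zfin] := pselect (emb nat Z).
    exact: small_emb (emb_square Zinf) sZ.
  by apply: finite_small; exact: not_emb_nat_prod.
move=> sX sY; have [XY|YX] := emb_total X Y.
  exact: small_emb (emb_prod XY (emb_refl _)) (sq _ sY).
exact: small_emb (emb_prod (emb_refl _) YX) (sq _ sX).
Qed.

Lemma not_emb_nat_bool : ~ emb nat bool.
Proof. by rewrite -card_le_emb -finite_setPn; exact: finite_finset. Qed.

Lemma small_sum X Y : small theta X -> small theta Y -> small theta (X + Y).
Proof.
have dbl Z : small theta Z -> small theta (Z + Z).
  move=> sZ; have := small_prod (finite_small not_emb_nat_bool) sZ; apply: small_emb.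
  exists (fun p => match p with inl x => (true, x) | inr x => (false, x) end).
  by move=> [x|x] [y|y] // [] ->.
move=> sX sY; have [XY|YX] := emb_total X Y.
  exact: small_emb (emb_sum XY (emb_refl _)) (dbl _ sY).
exact: small_emb (emb_sum (emb_refl _) YX) (dbl _ sX).
Qed.

Lemma small_unit : small theta unit.
Proof.
apply: finite_small => -[f fI].
by have /fI : f 0 = f 1 by case: (f 0); case: (f 1).
Qed.

(** Finite powers of a small type are small; functions on an index type are
    determined by their values along a list. *)
Lemma small_list W X (s : seq {classic W}) (Q : (W -> X) -> Prop) :
  (forall f g, Q f -> Q g -> (forall w, (w : {classic W}) \in s -> f w = g w) -> f = g) ->
  small theta X -> small theta {f | Q f}.
Proof.
move=> Qs sX.
have [Y [sY [e eE]]] : exists Y, small theta Y /\ exists e : (W -> X) -> Y,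
    forall f g, e f = e g -> forall w, (w : {classic W}) \in s -> f w = g w.
  elim: s {Qs} => [|w s [Y [sY [e eE]]]]; first by exists unit; split;
    [exact: small_unit|exists (fun=> tt)].
  exists (X * Y)%type; split; first exact: small_prod.
  exists (fun f => (f w, e f)) => f g [fw /eE efg] v; rewrite inE => /orP[/eqP ->//|]; exact: efg.
apply: small_emb sY; exists (e \o sval) => f g /eE fg.
by apply: sval_inj; apply: Qs fg; [exact: svalP f|exact: svalP g].
Qed.

End Small.

(** * Well-orders *)

(** Well-orders, as boolean relations. *)
Record wo (W : Type) (le : rel W) : Prop := Wo {
  wo_refl : forall x, le x x;
  wo_trans : forall y x z, le x y -> le y z -> le x z;
  wo_anti : forall x y, le x y -> le y x -> x = y;
  wo_total : forall x y, le x y \/ le y x;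
  wo_min : forall P : W -> Prop, (exists x, P x) ->
    exists2 m, P m & forall y, P y -> le m y
}.

Lemma wo_wf W (le : rel W) : wo le -> well_founded (fun x y => ~~ le y x).
Proof.
move=> h x; apply: contrapT => nx.
have [m nm mmin] := wo_min h (ex_intro (fun x => ~ Acc _ x) x nx).
apply: nm; constructor => y ny; apply: contrapT => nAy.
by rewrite mmin in ny.
Qed.

Lemma exists_wo X : exists le : rel X, wo le.
Proof.
have [R Rwo] := @well_ordering_principle {classic X}.
exists R; have tot : total R by move=> x y; apply: (wo_chainW (C := predT)) => // A _; exact: Rwo.
have anti : forall x y, R x y -> R y x -> x = y.
  move=> x y xy yx.
  have [|z [zP zu]] := Rwo [pred t : {classic X} | `[<t = x \/ t = y>]].
    by exists x; apply/asboolP; left.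
  have Rr : reflexive R by move=> t; have := tot t t; rewrite orbb.
  rewrite -(zu x); last first.
    by split; [apply/asboolP; left|move=> t /asboolP [] ->].
  by apply: zu; split; [apply/asboolP; right|move=> t /asboolP [] ->].
have min (P : X -> Prop) : (exists x, P x) -> exists2 m, P m & forall y, P y -> R m y.
  move=> [x Px]; have [|z [[/asboolP zP zm] _]] := Rwo [pred t : {classic X} | `[<P t>]].
    by exists x; apply/asboolP.
  by exists z => // y Py; apply: zm; apply/asboolP.
split=> //.
- by move=> x; have := tot x x; rewrite orbb.
- move=> y x z xy yz.
  have [|m [-> | [->|->]] mm] := min (fun t => t = x \/ t = y \/ t = z).
  + by exists x; left.
  + by apply: mm; right; right.
  + by rewrite (anti x y xy)//; apply: mm; left.
  + by rewrite -(anti y z yz) ?mm//; [right; left].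
- by move=> x y; apply/orP; exact: tot.
Qed.

Lemma wo_sub W (le : rel W) (P : W -> Prop) : wo le ->
  wo (fun x y : {w | P w} => le (sval x) (sval y)).
Proof.
move=> h; split.
- by move=> x; exact: wo_refl.
- by move=> y x z; exact: wo_trans.
- by move=> x y xy yx; apply: sval_inj; exact: wo_anti yx.
- by move=> x y; exact: wo_total.
- move=> Q [x Qx].
  have [|m [Pm Qm] mm] := wo_min h (P := fun w => exists h : P w, Q (exist _ w h)).
    by case: x Qx => w Pw Qw; exists w, Pw.
  exists (exist _ m Pm) => //= -[y Py] Qy; apply: mm; by exists Py.
Qed.

(** A well-ordered type W with the cardinality of theta, all of whose proper
    initial segments have a smaller cardinality. *)
Lemma initial_wo theta : exists (W : Type) (le : rel W),
  [/\ wo le, emb theta W, emb W theta &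
      forall b, ~ emb theta {g : W | ~~ le b g}].
Proof.
have [le h] := exists_wo theta.
have [ex|/forallNP no] := pselect (exists b, emb theta {g | ~~ le b g}); last first.
  exists theta, le; split=> //; exact: emb_refl.
have [m mP mmin] := wo_min h ex.
exists {g | ~~ le m g}, (fun x y => le (sval x) (sval y)); split=> //.
- exact: wo_sub.
- exact: emb_sig.
- move=> [b nb] /= eb; move: nb; rewrite mmin//.
  apply: emb_trans eb _.
  exists (fun x => exist (fun g => is_true (~~ le b g)) (sval (sval x)) (svalP x)).
  by move=> x y [] /sval_inj/sval_inj.
Qed.

(** * Chains of small directed subsets *)

(** Terms over V built with a constant, a unary and a binary operation. Their
    values form the closure of a family under these operations. *)
Inductive term (V : Type) : Type :=
| TBase | TVar of V | TUn of term V | TBin of term V & term V.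

Fixpoint tmap V V' (f : V -> V') (t : term V) : term V' :=
  match t with
  | TBase => TBase _ | TVar v => TVar (f v) | TUn t => TUn (tmap f t)
  | TBin t u => TBin (tmap f t) (tmap f u)
  end.

Fixpoint teval V I (i0 : I) (c : V -> I) (e : I -> I) (ub : I -> I -> I)
    (t : term V) : I :=
  match t with
  | TBase => i0 | TVar v => c v | TUn t => e (teval i0 c e ub t)
  | TBin t u => ub (teval i0 c e ub t) (teval i0 c e ub u)
  end.

Lemma teval_map V V' I (i0 : I) (f : V -> V') c e ub t :
  teval i0 c e ub (tmap f t) = teval i0 (c \o f) e ub t.
Proof. by elim: t => //= [t ->|t -> u ->]. Qed.

Lemma eq_teval V I (i0 : I) (c c' : V -> I) e ub :
  c =1 c' -> teval i0 c e ub =1 teval i0 c' e ub.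
Proof. by move=> cc'; elim=> //= [t ->|t -> u ->]. Qed.

Lemma term_emb V : emb nat V -> emb (term V) V.
Proof.
move=> Vinf; have [n nI] := Vinf; have [p pI] := emb_square Vinf.
have pI2 a b a' b' : p (a, b) = p (a', b') -> a = a' /\ b = b'.
  by move=> /pI [].
pose enc := fix enc t := match t with
  | TBase => p (n 0, n 0) | TVar v => p (n 1, v) | TUn t => p (n 2, enc t)
  | TBin t u => p (n 3, p (enc t, enc u)) end.
exists enc; elim=> [|v|t IHt|t IHt u IHu] [|v'|t'|t' u'] //= /pI2 [];
  try by move=> /nI.
- by move=> _ ->.
- by move=> _ /IHt ->.
- by move=> _ /pI2 [/IHt -> /IHu ->].
Qed.

(** A directed set contains an increasing well-ordered chain of small directed
    subsets whose union is cofinally closed under a given operation and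
    cofinally contains a given family of theta elements. *)
Lemma small_directed_chain theta I (le : I -> I -> Prop) (i0 : I)
    Z (c : Z -> I) (e : I -> I) :
  (forall i, le i i) -> (forall i j k, le i j -> le j k -> le i k) ->
  (forall i j, exists k, le i k /\ le j k) ->
  emb nat theta -> emb Z theta ->
  exists (W : Type) (leW : rel W) (K : W -> set I),
  [/\ wo leW, exists w : W, True,
      forall b g, leW b g -> K b `<=` K g &
      forall b, [/\ K b !=set0,
        forall i j, K b i -> K b j -> exists k, [/\ K b k, le i k & le j k] &
        small theta {i | K b i}]] /\
  [/\ forall z, exists b i, K b i /\ le (c z) i &
      forall b i, K b i -> exists b' i', K b' i' /\ le (e i) i'].
Proof.
move=> le_r le_t dir theta_inf Zt.
pose ub i j := sval (cid (dir i j)).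
have ubl i j : le i (ub i j) := (svalP (cid (dir i j))).1.
have ubr i j : le j (ub i j) := (svalP (cid (dir i j))).2.
(* For countable theta the chain consists of the initial segments of an
   increasing sequence, since closures under operations would be infinite. *)
have [theta_nat|theta_unc] := pselect (emb theta nat).
  have [d dI] := emb_trans Zt theta_nat.
  have h n : exists i, forall z, d z = n -> i = c z.
    have [[z <-]|no] := pselect (exists z, d z = n).
      by exists (c z) => z' /dI ->.
    by exists i0 => z dz; case: no; exists z.
  pose cn n := sval (cid (h n)).
  pose u := fix u n := if n is m.+1 then ub (u m) (ub (e (u m)) (cn m)) else i0.
  have u_mono m n : (m <= n)%N -> le (u m) (u n).
    elim: n => [|n IH]; first by rewrite leqn0 => /eqP ->.
    rewrite leq_eqVlt => /orP[/eqP ->//|]; rewrite ltnS => /IH mn.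
    exact: le_t mn (ubl _ _).
  exists nat, leq, (fun n => [set u k | k in [set k | (k <= n)%N]]); split; split.
  - split.
    + exact: leqnn.
    + by move=> y x z; exact: leq_trans.
    + by move=> x y xy yx; apply/eqP; rewrite eqn_leq xy.
    + by move=> x y; apply/orP; exact: leq_total.
    + move=> P [x Px]; have ex : exists n, `[<P n>] by exists x; apply/asboolP.
      exists (ex_minn ex); first by case: ex_minnP => m /asboolP.
      by case: ex_minnP => m _ mm y Py; apply: mm; apply/asboolP.
  - by exists 0.
  - by move=> b g bg _ [k /= kb <-]; exists k => //=; exact: leq_trans bg.
  - move=> n; split.
    + by exists (u 0), 0.
    + move=> _ _ [k /= kn <-] [l /= ln <-]; exists (u (maxn k l)); split.
      * by exists (maxn k l) => //=; rewrite geq_max kn.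
      * by apply: u_mono; rewrite leq_maxl.
      * by apply: u_mono; rewrite leq_maxr.
    + apply: finite_small => // nK.
      have : ~ emb nat 'I_n.+1 by rewrite -card_le_emb -finite_setPn; exact: finite_finset.
      apply; apply: emb_trans nK _.
      have hk (x : {i | [set u k | k in [set k | (k <= n)%N]] i}) :
          exists k : 'I_n.+1, u k = sval x.
        by case: x => _ [k /= kn <-]; exists (inord k); rewrite inordK.
      exists (fun x => sval (cid (hk x))) => x y xy; apply: sval_inj.
      by rewrite -(svalP (cid (hk x))) xy (svalP (cid (hk y))).
  - move=> z; exists (d z).+1, (u (d z).+1); split; first by exists (d z).+1 => /=.
    rewrite -(svalP (cid (h (d z))) z)//; apply: le_t (ubr _ _); exact: ubr.
  - move=> b _ [k _ <-]; exists k.+1, (u k.+1); split; first by exists k.+1 => /=.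
    by apply: le_t (ubr _ _); exact: ubl.
(* For uncountable theta, K b is the closure of the elements of the family
   with codes up to b under the operation e and a choice of upper bounds. *)
have [W [le' [h tW Wt seg]]] := initial_wo theta.
have [d dI] := emb_trans Zt tW.
have hc n : exists i, forall z, d z = n -> i = c z.
  have [[z <-]|no] := pselect (exists z, d z = n).
    by exists (c z) => z' /dI ->.
  by exists i0 => z dz; case: no; exists z.
pose cw w := sval (cid (hc w)).
pose K (b : W) := range (@teval {g | le' g b} I i0 (cw \o sval) e ub).
have sK b : small theta {g | le' g b}.
  have := small_sum theta_inf (conj (emb_trans (emb_sig _) Wt) (seg b)) (small_unit theta_inf).
  apply: small_emb.
  exists (fun x => match pselect (~~ le' b (sval x)) with
     | left p => inl (exist (fun g => is_true (~~ le' b g)) (sval x) p) | right _ => inr tt end).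
  move=> [x hx] [y hy] /=; case: pselect => p; case: pselect => q //.
    by move=> [xy]; apply: sval_inj.
  move=> _; apply: sval_inj => /=; apply: (wo_anti h).
    by apply: (wo_trans h hx); move/negP: q; rewrite negbK.
  by apply: (wo_trans h hy); move/negP: p; rewrite negbK.
exists W, le', K; split; split => //.
- by have [n _] := emb_trans theta_inf tW; exists (n 0).
- move=> b g bg _ [t _ <-].
  exists (tmap (fun x => exist (fun x => is_true (le' x g)) (sval x)
    (wo_trans h (svalP x) bg)) t) => //.
  by rewrite teval_map; exact: eq_teval.
- move=> b; split.
  + by exists i0; exists (TBase _).
  + move=> _ _ [t _ <-] [t' _ <-].
    exists (ub (teval i0 (cw \o sval) e ub t) (teval i0 (cw \o sval) e ub t')).
    by split=> //; exists (TBin t t').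
  + have natsmall : small theta nat by [].
    apply: small_emb (small_sum theta_inf (sK b) natsmall).
    apply: emb_trans (emb_range _) _.
    have Vinf : emb nat ({g | le' g b} + nat) by exists inr => x y [].
    apply: emb_trans (term_emb Vinf); exists (tmap inl).
    by elim=> [|v|t IHt|t IHt u IHu] [|v'|t'|t' u'] //= [] => [->|/IHt ->|/IHt -> /IHu ->].
- move=> z; exists (d z), (c z); split=> //.
  exists (TVar (exist (fun x => is_true (le' x (d z))) (d z) (wo_refl h (d z)))) => //=.
  exact: (svalP (cid (hc (d z)))).
- by move=> b _ [t _ <-]; exists b; eexists; split; [exists (TUn t)|exact: le_r].
Qed.

Local Open Scope ring_scope.

(** * Modules and homomorphisms *)

HB.instance Definition _ (R : rngType) (M N : rmodType R) (f : rhom M N) :=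
  GRing.isZmodMorphism.Build M N f (proj1 (rhomP f)).

Section Rhom.
Context {R : rngType}.
Implicit Types M N P : rmodType R.

Lemma rhom_act M N (f : rhom M N) m r : f (ract m r) = ract (f m) r.
Proof. exact: (proj2 (rhomP f)). Qed.

Lemma rhom_ext M N (f g : rhom M N) : f =1 g -> f = g.
Proof. by move=> /funext fg; apply: val_inj. Qed.

Lemma rhom_compE M N P (g : rhom N P) (f : rhom M N) x :
  rhom_comp g f x = g (f x).
Proof. by []. Qed.

Definition mk_rhom M N (f : M -> N) (h : is_rhom f) : rhom M N := RHom (asboolT h).

Lemma id_is_rhom M : @is_rhom R M M id. Proof. by []. Qed.

Definition rhom_id M : rhom M M := mk_rhom (@id_is_rhom M).

Lemma rhomB M N (f g : rhom M N) x : (f - g) x = f x - g x.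
Proof. by []. Qed.

Lemma ract0l M r : ract (0 : M) r = 0.
Proof. by apply: (addIr (ract 0 r)); rewrite -ractDl !add0r. Qed.

Lemma ractNl M (m : M) r : ract (- m) r = - ract m r.
Proof. by apply: (addIr (ract m r)); rewrite -ractDl !addNr ract0l. Qed.

Lemma ract_suml M I (s : seq I) (P : pred I) (F : I -> M) r :
  ract (\sum_(i <- s | P i) F i) r = \sum_(i <- s | P i) ract (F i) r.
Proof. by elim/big_rec2: _ => [|i x y _ <-]; rewrite ?ract0l// ractDl. Qed.

End Rhom.

(** Data defining a unitary submodule P of an abelian group V on which R acts,
    the action on V itself not being assumed unitary. *)
Record submod_data (R : rngType) := SubmodData {
  sm_V : zmodType;
  sm_act : sm_V -> R -> sm_V;
  sm_P : sm_V -> Prop;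
  sm_actA : forall v r s, sm_act v (rngmul r s) = sm_act (sm_act v r) s;
  sm_actDl : forall v w r, sm_act (v + w) r = sm_act v r + sm_act w r;
  sm_actDr : forall v r s, sm_act v (r + s) = sm_act v r + sm_act v s;
  sm_P0 : sm_P 0;
  sm_PB : forall v w, sm_P v -> sm_P w -> sm_P (v - w);
  sm_Pact : forall v r, sm_P v -> sm_P (sm_act v r);
  sm_unitary : forall v, sm_P v -> exists s : seq (sm_V * R),
    {in s, forall p, sm_P p.1} /\ v = \sum_(p <- s) sm_act p.1 p.2
}.

Section Submod.
Context {R : rngType} (d : submod_data R).

Definition sm_pred : {pred sm_V d} := fun v => `[< sm_P v >].

Lemma sm_zmod_closed : zmod_closed sm_pred.
Proof.
split; first by apply/asboolP; exact: sm_P0.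
by move=> v w /asboolP ? /asboolP ?; apply/asboolP; exact: sm_PB.
Qed.

HB.instance Definition _ :=
  GRing.isZmodClosed.Build (sm_V d) sm_pred sm_zmod_closed.

(** The submodule P of V as a type. *)
Record submod := Submod { smval :> sm_V d; _ : smval \in sm_pred }.

HB.instance Definition _ := [isSub for smval].
HB.instance Definition _ := [Choice of submod by <:].
HB.instance Definition _ := [SubChoice_isSubZmodule of submod by <:].

Lemma smP (x : submod) : sm_P (smval x).
Proof. by case: x => v h; apply/asboolP. Qed.

Definition mk_submod v (h : sm_P v) : submod := @Submod v (asboolT h).

Lemma smval_inj : injective smval. Proof. exact: val_inj. Qed.

Lemma smvalB (x y : submod) : smval (x - y) = smval x - smval y.
Proof. exact: (@raddfB _ _ (val : submod -> sm_V d)). Qed.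

Lemma smvalD (x y : submod) : smval (x + y) = smval x + smval y.
Proof. exact: (@raddfD _ _ (val : submod -> sm_V d)). Qed.

Lemma smval_sum I (s : seq I) (P : pred I) (F : I -> submod) :
  smval (\sum_(i <- s | P i) F i) = \sum_(i <- s | P i) smval (F i).
Proof. exact: (@raddf_sum _ _ (val : submod -> sm_V d)). Qed.

Definition submod_act (x : submod) (r : R) : submod :=
  mk_submod (sm_Pact r (smP x)).

Lemma submod_unitary x : exists s : seq (submod * R),
  x = \sum_(p <- s) submod_act p.1 p.2.
Proof.
have [s [sP xE]] := sm_unitary (smP x).
suff [t tE] : exists t : seq (submod * R),
    \sum_(p <- s) sm_act p.1 p.2 = \sum_(p <- t) sm_act (smval p.1) p.2.
  by exists t; apply: smval_inj; rewrite xE tE smval_sum.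
elim: s sP {xE} => [|p s IHs] sP; first by exists [::]; rewrite !big_nil.
have [|t tE] := IHs; first by move=> q qs; apply: sP; rewrite inE qs orbT.
have pP : sm_P p.1 by apply: sP; rewrite inE eqxx.
by exists ((mk_submod pP, p.2) :: t); rewrite !big_cons tE.
Qed.

Lemma submod_actA m r s :
  submod_act m (rngmul r s) = submod_act (submod_act m r) s.
Proof. by apply: smval_inj; exact: sm_actA. Qed.
Lemma submod_actDl m n r : submod_act (m + n) r = submod_act m r + submod_act n r.
Proof. by apply: smval_inj; rewrite smvalD -[LHS]/(sm_act (smval (m + n)) r) smvalD sm_actDl. Qed.
Lemma submod_actDr m r s : submod_act m (r + s) = submod_act m r + submod_act m s.
Proof. by apply: smval_inj; rewrite smvalD -[LHS]/(sm_act (smval m) (r + s)) sm_actDr. Qed.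

HB.instance Definition _ := Zmodule_isRModule.Build R submod
  submod_actA submod_actDl submod_actDr submod_unitary.

End Submod.

(** * Direct limits *)

(** Direct systems of abelian groups. *)
Record ab_system := AbSystem {
  ab_disp : Order.disp_t;
  ab_idx : porderType ab_disp;
  ab_inh : inhabited ab_idx;
  ab_dir : forall i j : ab_idx, exists k, (i <= k)%O /\ (j <= k)%O;
  ab_obj : ab_idx -> zmodType;
  ab_map : forall i j, (i <= j)%O -> ab_obj i -> ab_obj j;
  ab_morph : forall i j (ij : (i <= j)%O), zmod_morphism (ab_map ij);
  ab_map_id : forall i (ii : (i <= i)%O) x, ab_map ii x = x;
  ab_map_comp : forall i j k (ij : (i <= j)%O) (jk : (j <= k)%O)
    (ik : (i <= k)%O) x, ab_map jk (ab_map ij x) = ab_map ik x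
}.

Section Colim.
Variable S : ab_system.
Local Notation I := (ab_idx S).
Local Notation A := (@ab_obj S).
Local Notation a := (@ab_map S _ _).
Let a_morph := @ab_morph S.
Let a_id := @ab_map_id S.
Let a_comp := @ab_map_comp S.
Let dir := @ab_dir S.

(** The elements x and y have the same image at some later index. *)
Definition evt_eq (i : I) (x : A i) (j : I) (y : A j) : Prop :=
  exists k (ik : (i <= k)%O) (jk : (j <= k)%O), a ik x = a jk y.

Lemma evt_sym (i : I) (x : A i) (j : I) (y : A j) : evt_eq x y -> evt_eq y x.
Proof. by move=> [k [ik [jk e]]]; exists k, jk, ik. Qed.

Lemma evt_trans (i : I) (x : A i) (j : I) (y : A j) k (z : A k) :
  evt_eq x y -> evt_eq y z -> evt_eq x z.
Proof.
move=> [l [il [jl e]]] [m [jm [km f]]]; have [n [ln mn]] := dir l m.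
exists n, (le_trans il ln), (le_trans km mn).
rewrite -(a_comp il ln) e (a_comp jl ln (le_trans jl ln)).
by rewrite -(a_comp km mn) -f (a_comp jm mn (le_trans jl ln)).
Qed.

Lemma evt_map i j (ij : (i <= j)%O) x : evt_eq x (a ij x).
Proof. by exists j, ij, (lexx j); rewrite a_id. Qed.

(** The class of x for eventual equality. *)
Definition germ i (x : A i) : set {i & A i} := fun p => evt_eq x (projT2 p).

(** The direct limit, realized as the set of classes of eventually equal
    elements. *)
Record colim := Colim {
  colim_set : set {i & A i};
  _ : exists i (x : A i), colim_set = germ x }.

HB.instance Definition _ := gen_eqMixin colim.
HB.instance Definition _ := gen_choiceMixin colim.

(** The canonical map into the direct limit. *)
Definition cin i (x : A i) : colim :=
  Colim (ex_intro _ i (ex_intro _ x (erefl (germ x)))).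

Lemma cin_eq (i : I) (x : A i) (j : I) (y : A j) : cin x = cin y <-> evt_eq x y.
Proof.
split=> [[] e|e].
  have : germ y (existT _ j y) by exists j, (lexx j), (lexx j).
  by rewrite -e.
have : germ x = germ y.
  apply/seteqP; split=> -[k z]; rewrite /germ /=; last exact: evt_trans.
  by apply: evt_trans; exact: evt_sym.
by rewrite /cin; move: (ex_intro _ _ _) (ex_intro _ _ _) => h h' E; move: h h';
  rewrite E => h h'; congr Colim; exact: Prop_irrelevance.
Qed.

Lemma cin_map i j (ij : (i <= j)%O) x : cin (a ij x) = cin x.
Proof. by apply/cin_eq/evt_sym/evt_map. Qed.

Lemma colimP p : exists i (x : A i), p = cin x.
Proof.
case: p => p [i [x e]]; exists i, x; rewrite /cin; move: (ex_intro _ _ _) => h'.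
move: (ex_intro _ _ _) h' => h h'; subst p; congr Colim; exact: Prop_irrelevance.
Qed.

Lemma colimP2 p q : exists i (x y : A i), p = cin x /\ q = cin y.
Proof.
have [i [x ->]] := colimP p; have [j [y ->]] := colimP q.
have [k [ik jk]] := dir i j; exists k, (a ik x), (a jk y).
by rewrite !cin_map.
Qed.

Lemma colimP3 p q r : exists i (x y z : A i), [/\ p = cin x, q = cin y & r = cin z].
Proof.
have [i [x [y [-> ->]]]] := colimP2 p q; have [j [z ->]] := colimP r.
have [k [ik jk]] := dir i j; exists k, (a ik x), (a ik y), (a jk z).
by rewrite !cin_map.
Qed.

(** Binary operations that commute with the transition maps pass to the limit. *)
Lemma colim_op2 (F : forall i, A i -> A i -> A i) :
  (forall i j (ij : (i <= j)%O) x y, F j (a ij x) (a ij y) = a ij (F i x y)) ->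
  exists f : colim -> colim -> colim,
    forall i (x y : A i), f (cin x) (cin y) = cin (F i x y).
Proof.
move=> FP.
have h p q : exists r, forall i (x y : A i), p = cin x -> q = cin y -> r = cin (F i x y).
  have [i [x [y [-> ->]]]] := colimP2 p q; exists (cin (F i x y)).
  move=> j x' y' /cin_eq [k [ik [jk ex]]] /cin_eq [l [il [jl ey]]].
  have [m [km lm]] := dir k l.
  apply/cin_eq; exists m, (le_trans ik km), (le_trans jl lm); rewrite -!FP.
  congr (F m _ _).
    rewrite -(a_comp ik km) ex (a_comp jk km (le_trans jl lm)); exact: erefl.
  rewrite -(a_comp il lm (le_trans ik km)) ey (a_comp jl lm (le_trans jl lm)).
  exact: erefl.
exists (fun p q => sval (cid (h p q))) => i x y.
exact (svalP (cid (h (cin x) (cin y))) i x y erefl erefl).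
Qed.

Lemma a_B i j (ij : (i <= j)%O) x y : a ij x - a ij y = a ij (x - y).
Proof. by rewrite a_morph. Qed.

Lemma ab_map0 i j (ij : (i <= j)%O) : a ij 0 = 0.
Proof. by rewrite -(subrr 0) a_morph subrr. Qed.

Lemma ab_mapN i j (ij : (i <= j)%O) x : a ij (- x) = - a ij x.
Proof. by rewrite -[- x]sub0r a_morph ab_map0 sub0r. Qed.

Lemma a_D i j (ij : (i <= j)%O) x y : a ij x + a ij y = a ij (x + y).
Proof. by rewrite -{2}[y]opprK a_morph ab_mapN opprK. Qed.

Definition colim_add := sval (cid (colim_op2 a_D)).

Lemma colim_addE i (x y : A i) : colim_add (cin x) (cin y) = cin (x + y).
Proof. exact: (svalP (cid (colim_op2 a_D))). Qed.

Definition colim_sub := sval (cid (colim_op2 a_B)).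

Lemma colim_subE i (x y : A i) : colim_sub (cin x) (cin y) = cin (x - y).
Proof. exact: (svalP (cid (colim_op2 a_B))). Qed.

Let i0_ex : exists i : I, True.
Proof. by have [i] := ab_inh S; exists i. Qed.

Definition colim_zero := cin (0 : A (sval (cid i0_ex))).

Lemma colim_zeroE i : colim_zero = cin (0 : A i).
Proof.
have [k [jk ik]] := dir (sval (cid i0_ex)) i.
by apply/cin_eq; exists k, jk, ik; rewrite !ab_map0.
Qed.

Definition colim_opp p := colim_sub colim_zero p.

Lemma colim_addA : associative colim_add.
Proof.
move=> p q r; have [i [x [y [z [-> -> ->]]]]] := colimP3 p q r.
by rewrite !colim_addE addrA.
Qed.

Lemma colim_addC : commutative colim_add.
Proof.
move=> p q; have [i [x [y [-> ->]]]] := colimP2 p q.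
by rewrite !colim_addE addrC.
Qed.

Lemma colim_add0 : left_id colim_zero colim_add.
Proof.
by move=> p; have [i [x ->]] := colimP p; rewrite (colim_zeroE i) colim_addE add0r.
Qed.

Lemma colim_addN : left_inverse colim_zero colim_opp colim_add.
Proof.
move=> p; have [i [x ->]] := colimP p.
by rewrite /colim_opp (colim_zeroE i) colim_subE colim_addE sub0r addNr.
Qed.

HB.instance Definition _ := GRing.isZmodule.Build colim
  colim_addA colim_addC colim_add0 colim_addN.

Lemma cin_morph i : zmod_morphism (@cin i).
Proof.
move=> x y; rewrite -[RHS]/(colim_add (cin x) (colim_opp (cin y))).
by rewrite /colim_opp (colim_zeroE i) colim_subE colim_addE sub0r.
Qed.

Lemma cin_eq0 i (x : A i) : cin x = 0 -> exists j (ij : (i <= j)%O), a ij x = 0.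
Proof.
rewrite -[0 : colim]/(colim_zero) (colim_zeroE i) => /cin_eq[k [ik [ik' e]]].
by exists k, ik; rewrite e ab_map0.
Qed.

(** The maps induced by compatible families. *)
Lemma colim_induced (B : zmodType) (v : forall i, A i -> B) :
  (forall i, zmod_morphism (v i)) ->
  (forall i j (ij : (i <= j)%O) x, v j (a ij x) = v i x) ->
  exists2 h : colim -> B, zmod_morphism h & forall i (x : A i), h (cin x) = v i x.
Proof.
move=> vB va.
have hp p : exists b, forall i (x : A i), p = cin x -> b = v i x.
  have [i [x ->]] := colimP p; exists (v i x) => j y /cin_eq [k [ik [jk e]]].
  by rewrite -(va _ _ ik) e va.
have hE i (x : A i) : sval (cid (hp (cin x))) = v i x.
  exact (svalP (cid (hp (cin x))) i x erefl).
exists (fun p => sval (cid (hp p))) => // p q.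
have [i [x [y [-> ->]]]] := colimP2 p q.
by rewrite -cin_morph !hE vB.
Qed.

End Colim.

Section AbLimit.
Variable S : ab_system.
Local Notation A := (@ab_obj S).

(** An abstract direct limit of abelian groups is made of germs. *)
Lemma ab_limitP (L : zmodType) (u : forall i, A i -> L) :
  is_direct_limit_ab (@ab_map S) u ->
  (forall x, exists i (y : A i), u i y = x) /\
  (forall i (y : A i), u i y = 0 -> exists j (ij : (i <= j)%O), ab_map ij y = 0).
Proof.
move=> [uB ua uniq].
have ua' i j (ij : (i <= j)%O) x : u j (ab_map ij x) = u i x.
  by rewrite -(ua i j ij).
have [g gB gE] := colim_induced uB ua'.
have [|i j ij|h [[hB hE] _]] := uniq _ (@cin S); first exact: cin_morph.
  by apply/funext => x; exact: cin_map.
have gh x : g (h x) = x.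
  have [k [_ kU]] := uniq L u uB ua.
  have -> : g (h x) = k x.
    rewrite (kU (g \o h))//; split=> [y z|i]; first by rewrite /= hB gB.
    by apply/funext => y; rewrite /= -[h _]/((h \o u i) y) hE gE.
  by rewrite (kU id)//; split.
split=> [x|i y uy0].
  by have [i [y hx]] := colimP (h x); exists i, y; rewrite -(gh x) hx gE.
apply: cin_eq0; rewrite -(hE i) /= uy0.
by rewrite -(subrr 0) hB subrr.
Qed.

End AbLimit.

Section Limit.
Context {R : rngType}.
Implicit Types D : direct_system R.

Lemma ds_ab_morph D (i j : ds_idx D) (ij : (i <= j)%O) : zmod_morphism (ds_map ij).
Proof. exact: (proj1 (rhomP _)). Qed.

(** The direct system of abelian groups underlying a system of modules. *)
Definition ab_of_ds D : ab_system :=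
  @AbSystem _ (ds_idx D) (ds_inhabited D) (@ds_directed _ D) (fun i => ds_obj i)
    (fun i j ij => ds_map ij) (@ds_ab_morph D) (@ds_map_id _ D) (@ds_map_comp _ D).

Section ColimModule.
Variable D : direct_system R.
Local Notation C := (colim (ab_of_ds D)).
Local Notation cinD i := (@cin (ab_of_ds D) i).

Lemma ds_colim_act_subproof (p : C) (r : R) :
  exists q : C, forall i (x : D i), p = cinD i x -> q = cinD i (ract x r).
Proof.
have [i [x ->]] := colimP p; exists (cinD i (ract x r)) => j y /cin_eq [k [ik [jk e]]].
apply/cin_eq; exists k, ik, jk; rewrite /= in e *.
by rewrite !rhom_act e.
Qed.

Definition colim_act p r := sval (cid (ds_colim_act_subproof p r)).

Lemma colim_actE i (x : D i) r : colim_act (cinD i x) r = cinD i (ract x r).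
Proof. exact (svalP (cid (ds_colim_act_subproof (cinD i x) r)) i x erefl). Qed.

Lemma cinD_add i (x y : D i) : cinD i (x + y) = cinD i x + cinD i y.
Proof. by rewrite -[RHS]/(colim_add _ _) colim_addE. Qed.

Lemma colim_actA m r s : colim_act m (rngmul r s) = colim_act (colim_act m r) s.
Proof. by have [i [x ->]] := colimP m; rewrite !colim_actE ractA. Qed.

Lemma colim_actDl m n r : colim_act (m + n) r = colim_act m r + colim_act n r.
Proof.
have [i [x [y [-> ->]]]] := colimP2 m n.
by rewrite -cinD_add !colim_actE ractDl cinD_add.
Qed.

Lemma colim_actDr m r s : colim_act m (r + s) = colim_act m r + colim_act m s.
Proof. by have [i [x ->]] := colimP m; rewrite !colim_actE ractDr cinD_add. Qed.

Lemma colim_unitary m : exists s : seq (C * R),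
  m = \sum_(p <- s) colim_act p.1 p.2.
Proof.
have [i [x ->]] := colimP m; have [s xE] := ract_unitary x.
exists [seq (cinD i p.1, p.2) | p <- s]; rewrite big_map xE.
have cin0 : cinD i 0 = 0 by rewrite -(subrr 0) cin_morph subrr.
rewrite (big_morph _ (cinD_add (i := i)) cin0).
by apply: eq_bigr => p _; rewrite colim_actE.
Qed.

(** The direct limit of modules, on the direct limit of the underlying groups. *)
Definition ds_colim : Type := C.
HB.instance Definition _ := GRing.Zmodule.on ds_colim.
HB.instance Definition _ := Zmodule_isRModule.Build R ds_colim
  colim_actA colim_actDl colim_actDr colim_unitary.

Lemma cin_is_rhom i : @is_rhom R (D i) ds_colim (cinD i).
Proof. by split=> [x y|x r]; [exact: cin_morph|rewrite -colim_actE]. Qed.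

Definition ds_in i : rhom (D i) ds_colim := mk_rhom (@cin_is_rhom i).

Lemma ds_in_map i j (ij : (i <= j)%O) : rhom_comp (ds_in j) (ds_map ij) = ds_in i.
Proof. by apply: rhom_ext => x; exact: (@cin_map (ab_of_ds D)). Qed.

End ColimModule.

(** A cocone is a direct limit as soon as it is jointly surjective and every
    element that it kills is killed by some transition map. *)
Lemma direct_limit_of_germs D (L : rmodType R) (u : forall i, rhom (D i) L) :
  (forall i j (ij : (i <= j)%O) x, u j (ds_map ij x) = u i x) ->
  (forall x, exists i (y : D i), u i y = x) ->
  (forall i (y : D i), u i y = 0 -> exists j (ij : (i <= j)%O), ds_map ij y = 0) ->
  is_direct_limit u.
Proof.
move=> ua usurj uker; split=> [i j ij|N v vc]; first by apply: rhom_ext => x; exact: ua.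
have va i j (ij : (i <= j)%O) x : v j (ds_map ij x) = v i x.
  by rewrite -(vc i j ij).
have uv i (y : D i) : u i y = 0 -> v i y = 0.
  by move=> /uker [j [ij e]]; rewrite -(va _ _ ij) e raddf0.
have hx x : exists b, forall i (y : D i), u i y = x -> b = v i y.
  have [i [y <-]] := usurj x; exists (v i y) => j z e.
  have [k [ik jk]] := ds_directed i j.
  rewrite -(va _ _ ik) -(va _ _ jk); apply/eqP; rewrite -subr_eq0 -raddfB.
  by apply/eqP/uv; rewrite raddfB /= !ua e subrr.
pose h x := sval (cid (hx x)).
have hE i (y : D i) : h (u i y) = v i y by exact: (svalP (cid (hx (u i y)))).
have h_rhom : is_rhom h.
  split=> [x y|x r].
    have [i [x' <-]] := usurj x; have [j [y' <-]] := usurj y.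
    have [k [ik jk]] := ds_directed i j.
    by rewrite -(ua _ _ ik) -(ua _ _ jk) -raddfB !hE raddfB.
  by have [i [x' <-]] := usurj x; rewrite -rhom_act !hE rhom_act.
exists (mk_rhom h_rhom); split=> [i|g gu]; first by apply: rhom_ext => y; exact: hE.
apply: rhom_ext => x; have [i [y <-]] := usurj x.
by rewrite -[RHS]/(rhom_comp g (u i) y) gu [LHS]hE.
Qed.

(** Conversely, every direct limit of modules has these properties. *)
Lemma direct_limit_germs D (L : rmodType R) (u : forall i, rhom (D i) L) :
  is_direct_limit u ->
  [/\ forall i j (ij : (i <= j)%O) x, u j (ds_map ij x) = u i x,
      forall x, exists i (y : D i), u i y = x &
      forall i (y : D i), u i y = 0 ->
        exists j (ij : (i <= j)%O), ds_map ij y = 0].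
Proof.
move=> [uc uniq].
have ua i j (ij : (i <= j)%O) x : u j (ds_map ij x) = u i x by rewrite -(uc i j ij).
have [h [hE _]] := uniq _ _ (@ds_in_map D).
have [||g gB gE] := @colim_induced (ab_of_ds D) L (fun i => u i).
- by move=> i; exact: (proj1 (rhomP _)).
- exact: ua.
have g_rhom : @is_rhom R (ds_colim D) L g.
  split=> // m r; have [i [x ->]] := colimP m.
  by rewrite -[ract _ _]/(colim_act _ _) colim_actE !gE rhom_act.
have gh x : g (h x) = x.
  have [k [_ kU]] := uniq L u uc.
  rewrite -[LHS]/(rhom_comp (mk_rhom g_rhom) h x) -(kU (rhom_comp (mk_rhom g_rhom) h)); last first.
    by move=> i; apply: rhom_ext => y; rewrite /= -[h _]/(rhom_comp h (u i) y) hE gE.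
  rewrite (kU (rhom_id L))// => i; exact: rhom_ext.
split=> // [x|i y uy0].
  by have [i [y hx]] := colimP (h x); exists i, y; rewrite -(gh x) hx gE.
have : ds_in i y = 0 by rewrite -(hE i) rhom_compE uy0 raddf0.
exact: (@cin_eq0 (ab_of_ds D)).
Qed.

Lemma ds_colim_limit D : is_direct_limit (@ds_in D).
Proof.
apply: direct_limit_of_germs.
- by move=> i j ij x; exact: (@cin_map (ab_of_ds D)).
- by move=> x; have [i [y ->]] := colimP x; exists i, y.
- by move=> i y; exact: (@cin_eq0 (ab_of_ds D)).
Qed.

End Limit.

(** * Finitely presented modules and direct limits *)

Section Fp.
Context {R : rngType}.
Implicit Types (D : direct_system R) (P L M : rmodType R).

Lemma hom_morph D P (i j : ds_idx D) (ij : (i <= j)%O) :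
  zmod_morphism (rhom_comp (ds_map ij) : rhom P (D i) -> rhom P (D j)).
Proof. by move=> f g; apply: rhom_ext => x; exact: (raddfB (ds_map ij)). Qed.

Lemma hom_id D P (i : ds_idx D) (ii : (i <= i)%O) (f : rhom P (D i)) :
  rhom_comp (ds_map ii) f = f.
Proof. by apply: rhom_ext => x; exact: ds_map_id. Qed.

Lemma hom_comp D P (i j k : ds_idx D) (ij : (i <= j)%O) (jk : (j <= k)%O)
  (ik : (i <= k)%O) (f : rhom P (D i)) :
  rhom_comp (ds_map jk) (rhom_comp (ds_map ij) f) = rhom_comp (ds_map ik) f.
Proof. by apply: rhom_ext => x; exact: ds_map_comp. Qed.

(** The direct system of groups of homomorphisms from P. *)
Definition hom_system D P : ab_system :=
  @AbSystem _ (ds_idx D) (ds_inhabited D) (@ds_directed _ D)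
    (fun i => rhom P (D i)) (fun i j ij => rhom_comp (ds_map ij))
    (@hom_morph D P) (@hom_id D P) (@hom_comp D P).

(** A homomorphism from a finitely presented module to a direct limit factors
    through some term. *)
Lemma fp_lift D P L (u : forall i, rhom (D i) L) (f : rhom P L) :
  finitely_presented P -> is_direct_limit u ->
  exists i (g : rhom P (D i)), forall x, u i (g x) = f x.
Proof.
move=> Pfp /Pfp /(@ab_limitP (hom_system D P)) [/(_ f) [i [g gf]] _].
by exists i, g => x; rewrite -gf.
Qed.

(** Two homomorphisms from a finitely presented module to terms that agree in
    the limit agree at a later index. *)
Lemma fp_eq D P L (u : forall i, rhom (D i) L) i j (f : rhom P (D i)) (g : rhom P (D j)) :
  finitely_presented P -> is_direct_limit u -> (forall x, u i (f x) = u j (g x)) ->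
  exists k (ik : (i <= k)%O) (jk : (j <= k)%O),
    forall x, ds_map ik (f x) = ds_map jk (g x).
Proof.
move=> Pfp uL fg; have [ua _ _] := direct_limit_germs uL.
have [_ ker] := @ab_limitP (hom_system D P) _ _ (Pfp _ _ _ uL).
have [k [ik jk]] := ds_directed i j.
have [|l [kl e]] := ker k (rhom_comp (ds_map ik) f - rhom_comp (ds_map jk) g).
  apply: rhom_ext => x; rewrite rhom_compE rhomB raddfB /= !ua fg subrr.
  by [].
exists l, (le_trans ik kl), (le_trans jk kl) => x.
apply/eqP; rewrite -subr_eq0 -(ds_map_comp ik kl) -(ds_map_comp jk kl).
have : ds_map kl ((rhom_comp (ds_map ik) f - rhom_comp (ds_map jk) g) x) = 0.
  exact: (congr1 (fun h : rhom P (D l) => h x) e).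
by rewrite rhomB raddfB /= => ->.
Qed.

End Fp.

(** A theta-presented module in the class of direct limits of modules from F
    is the direct limit of a subsystem of a system of modules from F, which is
    exhausted by a well-ordered chain of directed subsystems that have fewer
    than theta terms. *)
Lemma presented_chain (R : rngType) (F : rmodType R -> Prop) theta (M : rmodType R) :
  emb nat theta -> (forall M, F M -> finitely_presented M) ->
  presented theta M -> lim_class F M ->
  exists (D : direct_system R) (u : forall i, rhom (D i) M)
    (W : Type) (leW : rel W) (K : W -> set (ds_idx D)),
  [/\ forall i, F (D i), wo leW, exists w : W, True,
      forall b g, leW b g -> K b `<=` K g &
      forall b, [/\ K b !=set0,
        forall i j, K b i -> K b j -> exists k, [/\ K b k, (i <= k)%O & (j <= k)%O] &
        small theta {i | K b i}]] /\
  [/\ forall i j (ij : (i <= j)%O) x, u j (ds_map ij x) = u i x,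
      forall x, exists b i (y : D i), K b i /\ u i y = x &
      forall b i (y : D i), K b i -> u i y = 0 ->
        exists b' j (ij : (i <= j)%O), K b' j /\ ds_map ij y = 0].
Proof.
move=> theta_inf Ffp [P [/card_le_emb Pt Pfp [p pM]]] [D [DF [u uM]]].
have [pa psurj pker] := direct_limit_germs pM.
have [ua usurj uker] := direct_limit_germs uM.
(* Each P j maps over M to some D (a j), and each D i to some P (b i). *)
have h1 j : exists i (f : rhom (P j) (D i)), forall x, u i (f x) = p j x.
  exact: fp_lift.
pose a j := sval (cid (h1 j)).
pose phi j : rhom (P j) (D (a j)) := sval (cid (svalP (cid (h1 j)))).
have phiE j x : u (a j) (phi j x) = p j x := svalP (cid (svalP (cid (h1 j)))) x.
have h2 i : exists j (f : rhom (D i) (P j)), forall x, p j (f x) = u i x.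
  by apply: fp_lift => //; exact: Ffp.
pose b i := sval (cid (h2 i)).
pose psi i : rhom (D i) (P (b i)) := sval (cid (svalP (cid (h2 i)))).
have psiE i x : p (b i) (psi i x) = u i x := svalP (cid (svalP (cid (h2 i)))) x.
(* The round trip from D i over P (b i) becomes the transition map at a later
   index k of D. *)
have h3 i : exists k (ik : (i <= k)%O) (jk : (a (b i) <= k)%O),
    forall x, ds_map ik x = ds_map jk (phi (b i) (psi i x)).
  apply: (fp_eq (f := rhom_id (D i)) (g := rhom_comp (phi (b i)) (psi i)) (Ffp _ (DF i)) uM).
  by move=> x; rewrite rhom_compE phiE psiE.
(* The maps phi become compatible with the transitions of P at a later index. *)
have h4 (z : ds_idx P * ds_idx P) : exists k, (a z.1 <= k)%O /\
    forall zz : (z.1 <= z.2)%O, exists (ik : (a z.1 <= k)%O) (jk : (a z.2 <= k)%O),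
      forall x, ds_map ik (phi z.1 x) = ds_map jk (phi z.2 (ds_map zz x)).
  case: z => j j'; have [jj'|njj'] := pselect (j <= j')%O; last by exists (a j).
  have [||k [ik [jk e]]] := fp_eq (f := phi j) (g := rhom_comp (phi j') (ds_map jj')) _ uM.
  - exact: Pfp.
  - by move=> x; rewrite rhom_compE !phiE pa.
  exists k; split=> // zz; exists ik, jk => x.
  by rewrite e rhom_compE (bool_irrelevance jj' zz).
have [i0] := ds_inhabited D.
have [W [leW [K [[Wwo W0 Kmono Kb] [Kc Ke]]]]] := @small_directed_chain theta (ds_idx D)
  (fun i j => (i <= j)%O) i0 _ (fun z => sval (cid (h4 z))) (fun i => sval (cid (h3 i)))
  (fun i => lexx i) (fun i j k => @le_trans _ _ j i k) (@ds_directed _ D) theta_inf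
  (emb_trans (emb_prod Pt Pt) (emb_square theta_inf)).
exists D, u, W, leW, K; split; split=> //.
- move=> x; have [j [y <-]] := psurj x.
  have [w [i [Ki le_i]]] := Kc (j, j).
  have aji := le_trans (svalP (cid (h4 (j, j)))).1 le_i.
  by exists w, i, (ds_map aji (phi j y)); rewrite ua phiE.
- move=> w i y Ki uy0.
  have [|j' [jj' e]] := pker (b i) (psi i y); first by rewrite psiE.
  have [w1 [i1 [K1 l1]]] := Ke w i Ki.
  have [w2 [i2 [K2 l2]]] := Kc (b i, j').
  have [w' [K1' K2']] : exists w', K w' i1 /\ K w' i2.
    have [w12|w21] := wo_total Wwo w1 w2.
      by exists w2; split=> //; exact: (Kmono _ _ w12).
    by exists w1; split=> //; exact: (Kmono _ _ w21).
  have [_ /(_ _ _ K1' K2') [k [Kk i1k i2k]] _] := Kb w'.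
  have [e1 [e2 ee]] := svalP (cid (h3 i)).
  have [_ /(_ jj') [c1 [c2 cc]]] := svalP (cid (h4 (b i, j'))).
  have ek := le_trans l1 i1k; have ck := le_trans l2 i2k.
  have ik := le_trans e1 ek.
  exists w', k, ik; split=> //.
  rewrite -(ds_map_comp e1 ek) ee (ds_map_comp e2 ek (le_trans e2 ek)).
  rewrite (bool_irrelevance (le_trans e2 ek) (le_trans c1 ck)) -(ds_map_comp c1 ck).
  by rewrite cc /= e !raddf0.
Qed.

(** * Step functions on a tree *)

Lemma finite_set_seq T (A : set T) : finite_set A ->
  exists s : seq {classic T}, forall x : {classic T}, A x <-> x \in s.
Proof.
move=> Afin; have /finite_seqP[s As] : finite_set (A : set {classic T}) by [].
by exists s => x; rewrite As.
Qed.

Lemma finite_max W (le : rel W) (P : set W) : wo le -> finite_set P -> P !=set0 ->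
  exists2 m, P m & forall y, P y -> le y m.
Proof.
move=> h /finite_set_seq [s Ps] [x /Ps xs].
suff [m ms mm] : exists2 m : {classic W}, m \in s & forall y : {classic W}, y \in s -> le y m.
  by exists m => [|y /Ps]; [apply/Ps|exact: mm].
elim: s x xs {Ps} => // a s IHs x _.
case: s IHs => [_|b s /(_ b) []].
  by exists a; rewrite ?inE// => y; rewrite inE => /eqP ->; exact: wo_refl.
  by rewrite inE eqxx.
move=> m ms mm; have [am|ma] := wo_total h a m.
  by exists m => [|y]; rewrite inE ?ms ?orbT// => /orP[/eqP -> //|]; exact: mm.
exists a => [|y]; rewrite inE ?eqxx// => /orP[/eqP ->|/mm ym]; first exact: wo_refl.
exact: (wo_trans h ym).
Qed.

(** A system of modules and homomorphisms indexed by an ordered type. *)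
Record chain_system (R : rngType) (W : Type) (le : rel W) := ChainSystem {
  ch_obj :> W -> rmodType R;
  ch_map : forall b g, le b g -> rhom (ch_obj b) (ch_obj g);
  ch_map_id : forall b (bb : le b b) x, ch_map bb x = x;
  ch_map_comp : forall a b g (ab : le a b) (bg : le b g) (ag : le a g) x,
    ch_map bg (ch_map ab x) = ch_map ag x
}.

(** A tree given by its set T of branches: eqv b x y says that x and y pass
    through the same node of level b. *)
Record tree (W : Type) (le : rel W) (T : Type) (eqv : W -> T -> T -> Prop) : Prop := Tree {
  tree_refl : forall b x, eqv b x x;
  tree_sym : forall b x y, eqv b x y -> eqv b y x;
  tree_trans : forall b x y z, eqv b x y -> eqv b y z -> eqv b x z;
  tree_mono : forall b g x y, le b g -> eqv g x y -> eqv b x y;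
  tree_sep : forall x y, x <> y -> exists b, ~ eqv b x y
}.

Section Step.
Context {R : rngType} {W : Type} {le : rel W} (hW : wo le).
Variable bot : W.
Hypothesis botP : forall w, le bot w.
Context {T : Type} {eqv : W -> T -> T -> Prop} (hT : tree le eqv).
Implicit Types (A : chain_system R le) (E : set T) (S : set W).

(** The functions of a branch and a level b, with values in A b. The functions
    on the nodes of the tree are those that give the same value to all the
    branches through a node. *)
Definition amb A : Type := T -> forall b, A b.

Section Amb.
Variable A : chain_system R le.

HB.instance Definition _ := gen_eqMixin (amb A).
HB.instance Definition _ := gen_choiceMixin (amb A).

Lemma amb_ext (f g : amb A) : (forall x b, f x b = g x b) -> f = g.
Proof. by move=> fg; apply/funext => x; apply: functional_extensionality_dep => b. Qed.

Lemma amb_addA : associative (fun f g : amb A => (fun x b => f x b + g x b) : amb A).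
Proof. by move=> f g k; apply: amb_ext => x b; rewrite addrA. Qed.
Lemma amb_addC : commutative (fun f g : amb A => (fun x b => f x b + g x b) : amb A).
Proof. by move=> f g; apply: amb_ext => x b; rewrite addrC. Qed.
Lemma amb_add0 : left_id ((fun _ _ => 0) : amb A)
  (fun f g : amb A => (fun x b => f x b + g x b) : amb A).
Proof. by move=> f; apply: amb_ext => x b; rewrite add0r. Qed.
Lemma amb_addN : left_inverse ((fun _ _ => 0) : amb A)
  (fun f : amb A => (fun x b => - f x b) : amb A)
  (fun f g : amb A => (fun x b => f x b + g x b) : amb A).
Proof. by move=> f; apply: amb_ext => x b; rewrite addNr. Qed.

HB.instance Definition _ := GRing.isZmodule.Build (amb A)
  amb_addA amb_addC amb_add0 amb_addN.

(** The pointwise action, under which amb A need not be unitary. *)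
Definition amb_act (f : amb A) (r : R) : amb A := fun x b => ract (f x b) r.

Lemma amb_sumE I (s : seq I) (F : I -> amb A) x b :
  (\sum_(i <- s) F i) x b = \sum_(i <- s) F i x b.
Proof.
elim: s => [|i s IHs]; rewrite ?big_nil// !big_cons -IHs; by [].
Qed.

(** The functions on the nodes that are supported by the nodes on branches from
    E and that follow the maps of A between consecutive levels of S. *)
Definition is_step E S (f : amb A) : Prop :=
  [/\ forall b x y, eqv b x y -> f x b = f y b,
      forall b x, (forall e, E e -> ~ eqv b x e) -> f x b = 0 &
      forall b g (bg : le b g) x, (exists2 e, E e & eqv g x e) ->
        (forall s, S s -> le s g -> le s b) -> f x g = ch_map A bg (f x b)].

Lemma is_step0 E S : is_step E S 0.
Proof. by split=> // b g bg x _ _; rewrite raddf0. Qed.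

Lemma is_stepB E S f g : is_step E S f -> is_step E S g -> is_step E S (f - g).
Proof.
move=> [f1 f2 f3] [g1 g2 g3]; split.
- by move=> b x y xy; rewrite -[LHS]/(f x b - g x b) (f1 b x y)// (g1 b x y).
- by move=> b x nx; rewrite -[LHS]/(f x b - g x b) f2// g2// subrr.
- move=> b c bc x ex sP; rewrite -[LHS]/(f x c - g x c) (f3 b c bc)// (g3 b c bc)//.
  by rewrite -raddfB.
Qed.

Lemma is_stepD E S f g : is_step E S f -> is_step E S g -> is_step E S (f + g).
Proof.
move=> fP gP; rewrite -[g]opprK; apply: is_stepB => //.
by rewrite -[- g]sub0r; apply: is_stepB => //; exact: is_step0.
Qed.

Lemma is_step_act E S f r : is_step E S f -> is_step E S (amb_act f r).
Proof.
move=> [f1 f2 f3]; split; rewrite /amb_act.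
- by move=> b x y xy; rewrite (f1 b x y).
- by move=> b x nx; rewrite f2// ract0l.
- by move=> b c bc x ex sP; rewrite (f3 b c bc)// rhom_act.
Qed.

Lemma is_step_sum E S I (s : seq I) (F : I -> amb A) :
  (forall i, is_step E S (F i)) -> is_step E S (\sum_(i <- s) F i).
Proof.
move=> FP; elim: s => [|i s IHs]; rewrite ?big_nil ?big_cons; first exact: is_step0.
exact: is_stepD.
Qed.

End Amb.

(** Every level is preceded by a last level of S. *)
Lemma last_level S g : finite_set S -> S bot ->
  exists b, [/\ S b, le b g & forall s, S s -> le s g -> le s b].
Proof.
move=> Sfin S0; have [||m [Sm mg] mm] := @finite_max _ _ (S `&` [set b | le b g]) hW.
- exact: finite_setIl.
- by exists bot; split=> //=.
- by exists m; split=> // s Ss sg; apply: mm.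
Qed.

(** E and S are finite, S contains the bottom level, and two branches from E
    that share a node of level b but none of level g split at a level of S
    between b and g. *)
Definition adapted E S : Prop :=
  [/\ finite_set E, finite_set S, S bot &
      forall x y b g, E x -> E y -> le b g -> eqv b x y -> ~ eqv g x y ->
        exists s, [/\ S s, ~ le s b & le s g]].

Lemma adapted_ex E S : finite_set E -> finite_set S ->
  exists2 S', adapted E S' & S `<=` S'.
Proof.
move=> Efin Sfin.
have h (p : T * T) : exists s, forall g, ~ eqv g p.1 p.2 -> ~ eqv s p.1 p.2 /\ le s g.
  have [ex|no] := pselect (exists g, ~ eqv g p.1 p.2).
    by have [m nm mm] := wo_min hW ex; exists m => g ng; split=> //; exact: mm.
  by exists bot => g ng; case: no; exists g.
pose d p := sval (cid (h p)).
exists (S `|` (d @` (E `*` E) `|` [set bot])); last by move=> s; left.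
split=> //.
- rewrite finite_setU; split=> //; rewrite finite_setU; split; last exact: finite_set1.
  exact/finite_image/finite_setX.
- by right; right.
- move=> x y b g Ex Ey bg exy nxy; have [nd dg] := svalP (cid (h (x, y))) g nxy.
  exists (d (x, y)); split=> //; first by right; left; exists (x, y).
  by move=> /(tree_mono hT)/(_ exy).
Qed.

(** A step function over E and S is one over any larger adapted pair: the
    branches of the larger set leave the support of f at levels of S' only. *)
Lemma is_step_mono A E S E' S' (f : amb A) : adapted E' S' -> E `<=` E' -> S `<=` S' ->
  is_step E S f -> is_step E' S' f.
Proof.
move=> [_ _ _ split'] EE SS [f1 f2 f3]; split=> //.
  by move=> b x nx; apply: f2 => e /EE; exact: nx.
move=> b g bg x [e' Ee' xe'] sP.
have [[e Ee xe]|no] := pselect (exists2 e, E e & eqv g x e).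
  by apply: f3; [exists e|move=> s /SS; exact: sP].
rewrite (f2 g x); last by move=> e Ee xe; apply: no; exists e.
have [[e Ee xe]|no'] := pselect (exists2 e, E e & eqv b x e); last first.
  by rewrite (f2 b x) ?raddf0// => e Ee xe; apply: no'; exists e.
have [||s [Ss sb sg]] := split' e e' b g (EE _ Ee) Ee' bg.
- exact: (tree_trans hT (tree_sym hT xe)) (tree_mono hT bg xe').
- by move=> ee'; apply: no; exists e => //; exact: (tree_trans hT xe' (tree_sym hT ee')).
- by case: sb; exact: sP.
Qed.

(** Step functions are determined by their values on the nodes over E and S. *)
Lemma step_eq A E S (f g : amb A) : adapted E S -> is_step E S f -> is_step E S g ->
  (forall e b, E e -> S b -> f e b = g e b) -> f = g.
Proof.
move=> [_ Sfin S0 _] [f1 f2 f3] [g1 g2 g3] fg; apply: amb_ext => x c.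
have [[e Ee xe]|no] := pselect (exists2 e, E e & eqv c x e); last first.
  by rewrite f2 ?g2// => e Ee xe; apply: no; exists e.
have [b [Sb bc bm]] := last_level c Sfin S0.
rewrite (f1 c x e)// (g1 c x e)// (f3 b c bc) ?(g3 b c bc) ?fg//; exists e => //;
  exact: (tree_refl hT).
Qed.

(** A step function can be prescribed on the nodes over E and S. *)
Lemma step_ext A E S (c : amb A) : adapted E S ->
  (forall e e' b, E e -> E e' -> S b -> eqv b e e' -> c e b = c e' b) ->
  exists2 f, is_step E S f & forall e b, E e -> S b -> f e b = c e b.
Proof.
move=> [_ Sfin S0 _] cP.
have h x g : exists v : A g, (forall e b (bg : le b g), E e -> eqv g x e -> S b ->
    (forall s, S s -> le s g -> le s b) -> v = ch_map A bg (c e b)) /\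
    ((forall e, E e -> ~ eqv g x e) -> v = 0).
  have [[e Ee xe]|no] := pselect (exists2 e, E e & eqv g x e); last first.
    exists 0; split=> // e b bg Ee xe; exfalso; apply: no; by exists e.
  have [b [Sb bg bm]] := last_level g Sfin S0.
  exists (ch_map A bg (c e b)); split; last by move=> /(_ e Ee).
  move=> e' b' b'g Ee' xe' Sb' bm'.
  have bb' : b = b' by apply: (wo_anti hW); [exact: bm'|exact: bm].
  subst b'; rewrite (bool_irrelevance b'g bg); congr (ch_map A bg _).
  apply: cP => //; apply: (tree_mono hT bg); apply: (tree_trans hT _ xe'); exact: (tree_sym hT).
pose f : amb A := fun x g => sval (cid (h x g)).
have fE x g e b (bg : le b g) : E e -> eqv g x e -> S b ->
    (forall s, S s -> le s g -> le s b) -> f x g = ch_map A bg (c e b).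
  exact: (svalP (cid (h x g))).1.
have f0 x g : (forall e, E e -> ~ eqv g x e) -> f x g = 0.
  exact: (svalP (cid (h x g))).2.
exists f; last first.
  move=> e b Ee Sb; rewrite (fE e b e b (wo_refl hW b))//; first by rewrite ch_map_id.
  exact: (tree_refl hT).
split; last 1 first.
- move=> b g bg x [e Ee xe] sP.
  have [b' [Sb' b'g bm]] := last_level g Sfin S0.
  have b'b := sP _ Sb' b'g.
  rewrite (fE x g e b' b'g)// (fE x b e b' b'b)//; first by rewrite (ch_map_comp _ _ b'g).
    exact: (tree_mono hT bg).
  by move=> s Ss sb; apply: bm => //; exact: (wo_trans hW sb).
- move=> b x y xy; have [[e Ee xe]|no] := pselect (exists2 e, E e & eqv b x e).
    have [b' [Sb' b'b bm]] := last_level b Sfin S0.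
    rewrite (fE x b e b' b'b)// (fE y b e b' b'b)//.
    exact: (tree_trans hT (tree_sym hT xy)).
  rewrite !f0// => e Ee ye; apply: no; exists e => //; exact: (tree_trans hT xy).
- by move=> b x nx; exact: f0.
Qed.

(** Finitely many nodes determine the step functions over E and S freely. *)
Lemma step_basis E S : adapted E S ->
  exists n (k : 'I_n -> T * W), (forall i, E (k i).1 /\ S (k i).2) /\
    forall A (x : forall i, A (k i).2),
      exists! f : amb A, is_step E S f /\ forall i, f (k i).1 (k i).2 = x i.
Proof.
move=> ad; have [Efin Sfin S0 _] := ad.
have [sE EP] := finite_set_seq Efin; have [sS SP] := finite_set_seq Sfin.
(* A representative of each node that depends on the node only. *)
have [rep [repP rep_eq]] : exists rep : W -> T -> T,
    (forall b e, E e -> E (rep b e) /\ eqv b e (rep b e)) /\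
    (forall b e e', E e -> E e' -> eqv b e e' -> rep b e = rep b e').
  pose cls b e : set T := [set e' | E e' /\ eqv b e e'].
  pose rep b e := match pselect (exists e', cls b e e') with
    | left h => sval (cid h) | right _ => e end.
  exists rep; split.
    move=> b e Ee; rewrite /rep; case: pselect => [h|]; first exact: (svalP (cid h)).
    by case; exists e; split=> //; exact: (tree_refl hT).
  move=> b e e' Ee Ee' ee'; rewrite /rep.
  have -> : cls b e = cls b e'.
    apply/seteqP; split=> z [Ez ez]; split=> //; last exact: (tree_trans hT ee').
    exact: (tree_trans hT (tree_sym hT ee')).
  case: pselect => [//|]; case; exists e'; split=> //; exact: (tree_refl hT).
pose s := undup [seq ((rep b e, b) : {classic T} * {classic W}) |
  e : {classic T} <- sE, b : {classic W} <- sS].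
pose k (i : 'I_(size s)) : T * W := tnth (in_tuple s) i.
have kP i : exists e b, [/\ E e, S b & k i = (rep b e, b)].
  have : tnth (in_tuple s) i \in s by exact: mem_tnth.
  rewrite mem_undup => /allpairsPdep[e [b [es bs eq]]].
  by exists e, b; split; [apply/EP|apply/SP|exact: eq].
have kES i : E (k i).1 /\ S (k i).2.
  have [e [b [Ee Sb ->]]] := kP i; split=> //=; exact: (repP b e Ee).1.
have kex e b : E e -> S b -> exists i, (k i).2 = b /\ eqv b (k i).1 e.
  move=> Ee Sb; have ks : ((rep b e, b) : {classic T} * {classic W}) \in s.
    by rewrite mem_undup; apply: allpairs_f_dep; [apply/EP|apply/SP].
  have [i ki] : exists i, tnth (in_tuple s) i = (rep b e, b).
    by have /tnthP [i ->] : (rep b e, b) \in in_tuple s by []; exists i.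
  exists i; rewrite /k ki; split=> //=; exact: (tree_sym hT (repP b e Ee).2).
have kuniq i j : (k i).2 = (k j).2 -> eqv (k i).2 (k i).1 (k j).1 -> i = j.
  move=> eq2 eq1; have /tuple_uniqP : uniq (in_tuple s) by exact: undup_uniq.
  apply.
  have [e [b [Ee Sb kE]]] := kP i; have [e' [b' [Ee' Sb' kE']]] := kP j.
  move: eq1 eq2; rewrite -/(k i) -/(k j) kE kE' /= => eq1 bb'; subst b'.
  congr (_, _); apply: rep_eq => //.
  apply: (tree_trans hT (repP b e Ee).2); apply: (tree_trans hT eq1).
  exact: (tree_sym hT (repP b e' Ee').2).
exists (size s), k; split=> // A x.
have h e b : exists v : A b, forall i (h : le (k i).2 b), le b (k i).2 ->
    eqv b (k i).1 e -> v = ch_map A h (x i).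
  have [[i [ib bi ie]]|no] := pselect (exists i, [/\ le (k i).2 b, le b (k i).2 & eqv b (k i).1 e]);
    last by exists 0 => i ib bi ie; case: no; exists i.
  exists (ch_map A ib (x i)) => j jb bj je.
  have ij : i = j.
    have bE : (k i).2 = b by exact: (wo_anti hW).
    have bE' : (k j).2 = b by exact: (wo_anti hW).
    apply: kuniq; rewrite bE ?bE'//.
    exact: (tree_trans hT ie (tree_sym hT je)).
  by subst j; rewrite (bool_irrelevance jb ib).
pose c : amb A := fun e b => sval (cid (h e b)).
have cE e b i (ib : le (k i).2 b) : le b (k i).2 -> eqv b (k i).1 e -> c e b = ch_map A ib (x i).
  exact: (svalP (cid (h e b))).
have [|f fstep fE] := @step_ext A E S c ad.
  move=> e e' b Ee Ee' Sb ee'; have [i [ib ie]] := kex e b Ee Sb.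
  subst b; rewrite (cE e _ i (wo_refl hW _))// ?(wo_refl hW)//.
  rewrite (cE e' _ i (wo_refl hW _))// ?(wo_refl hW)//.
  exact: (tree_trans hT ie).
exists f; split.
  split=> // i; rewrite fE//; try by case: (kES i).
  rewrite (cE _ _ i (wo_refl hW _)) ?(wo_refl hW)// ?ch_map_id//; exact: (tree_refl hT).
move=> g [gstep gE]; apply: (step_eq ad) => // e b Ee Sb.
have [i [ib ie]] := kex e b Ee Sb; subst b.
have [f1 _ _] := fstep; have [g1 _ _] := gstep.
rewrite -(f1 _ _ _ ie) -(g1 _ _ _ ie) gE fE//; try by case: (kES i).
rewrite (cE _ _ i (wo_refl hW _)) ?(wo_refl hW)// ?ch_map_id//; exact: (tree_refl hT).
Qed.

End Step.

(** * Chains of direct limits *)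

(** Posets presented by a Prop-valued order. *)
Record prop_order := PropOrder {
  po_sort : Type;
  po_le : po_sort -> po_sort -> Prop;
  po_refl : forall x, po_le x x;
  po_anti : forall x y, po_le x y -> po_le y x -> x = y;
  po_trans : forall y x z, po_le x y -> po_le y z -> po_le x z
}.

Section PoType.
Variable p : prop_order.

(** The order is made boolean classically. *)
Definition po_type : Type := po_sort p.

HB.instance Definition _ := gen_eqMixin po_type.
HB.instance Definition _ := gen_choiceMixin po_type.

Definition po_leb : rel po_type := fun x y => `[< po_le x y >].

Lemma po_leb_refl : reflexive po_leb.
Proof. by move=> x; apply/asboolP; exact: po_refl. Qed.
Lemma po_leb_anti : antisymmetric po_leb.
Proof. by move=> x y /andP[/asboolP xy /asboolP yx]; exact: po_anti yx. Qed.
Lemma po_leb_trans : transitive po_leb.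
Proof. by move=> y x z /asboolP xy /asboolP yz; apply/asboolP; exact: po_trans yz. Qed.

HB.instance Definition _ := @Order.Le_isPOrder.Build (Order.Disp tt tt) po_type
  po_leb po_leb_refl po_leb_anti po_leb_trans.

Lemma po_typeP (x y : po_type) : reflect (po_le x y) (x <= y)%O.
Proof. exact: asboolP. Qed.

End PoType.

Section SubSystem.
Context {R : rngType} (D : direct_system R) (J : set (ds_idx D)).

(** The subset J with the induced order. *)
Definition sub_order : prop_order.
Proof.
refine (@PropOrder {i | J i} (fun i j => (sval i <= sval j)%O) _ _ _).
- by move=> i; exact: lexx.
- by move=> i j ij ji; apply: sval_inj; apply/eqP; rewrite eq_le ij.
- by move=> j i k; exact: le_trans.
Defined.

Hypothesis J0 : J !=set0.
Hypothesis Jdir : forall i j, J i -> J j -> exists k, [/\ J k, (i <= k)%O & (j <= k)%O].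

Definition sub_system : direct_system R.
Proof.
refine (@DirectSystem R _ (po_type sub_order) _ _ (fun i => D (sval i))
  (fun i j ij => ds_map (elimT (po_typeP i j) ij)) _ _).
- by have [i Ji] := J0; constructor; exists i.
- move=> [i Ji] [j Jj]; have [k [Jk ik jk]] := Jdir Ji Jj.
  by exists (exist _ k Jk); split; apply/po_typeP.
- by move=> i ii x; exact: ds_map_id.
- by move=> i j k ij jk ik x; exact: ds_map_comp.
Defined.

End SubSystem.

(** The chain of direct limits of an increasing chain of directed subsystems. *)
Lemma chain_colim (R : rngType) (D : direct_system R) (M : rmodType R)
    (u : forall i, rhom (D i) M) W (le : rel W) (K : W -> set (ds_idx D)) :
  (forall i j (ij : (i <= j)%O) x, u j (ds_map ij x) = u i x) ->
  (forall b g, le b g -> K b `<=` K g) ->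
  (forall b, K b !=set0) ->
  (forall b i j, K b i -> K b j -> exists k, [/\ K b k, (i <= k)%O & (j <= k)%O]) ->
  exists (A : chain_system R le) (v : forall b i, K b i -> rhom (D i) (A b))
      (w : forall b, rhom (A b) M),
  [/\ forall b g (bg : le b g) i (bi : K b i) (gi : K g i) x,
        ch_map A bg (v b i bi x) = v g i gi x,
      forall b i j (bi : K b i) (bj : K b j) (ij : (i <= j)%O) x,
        v b j bj (ds_map ij x) = v b i bi x,
      forall b y, exists i (bi : K b i) x, v b i bi x = y,
      forall b i (bi : K b i) x, v b i bi x = 0 ->
        exists j (ij : (i <= j)%O), K b j /\ ds_map ij x = 0 &
      forall b i (bi : K b i) x, w b (v b i bi x) = u i x].
Proof.
move=> ua Kmono K0 Kdir.
pose S b := sub_system (K0 b) (Kdir b).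
pose A b : rmodType R := ds_colim (S b).
pose v b i (bi : K b i) : rhom (D i) (A b) := @ds_in R (S b) (exist _ i bi).
have SL b := @ds_colim_limit R (S b).
have vsurj b y : exists i (bi : K b i) x, v b i bi x = y.
  have [_ surj _] := direct_limit_germs (SL b).
  by have [[i bi] [x xE]] := surj y; exists i, bi, x.
have vmap b i j (bi : K b i) (bj : K b j) (ij : (i <= j)%O) x :
    v b j bj (ds_map ij x) = v b i bi x.
  have [c _ _] := direct_limit_germs (SL b).
  have ij' : ((exist _ i bi : ds_idx (S b)) <= exist _ j bj)%O by exact/po_typeP.
  rewrite -[RHS](c _ _ ij'); congr (v b j bj (ds_map _ _)); exact: bool_irrelevance.
have vker b i (bi : K b i) x : v b i bi x = 0 ->
    exists j (ij : (i <= j)%O), K b j /\ ds_map ij x = 0.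
  have [_ _ ker] := direct_limit_germs (SL b).
  by move=> /ker [[j bj] [ij e]]; exists j; eexists; split; [exact: bj|exact: e].
have ind b (N : rmodType R) (f : forall i, K b i -> rhom (D i) N) :
    (forall i j bi bj (ij : (i <= j)%O) x, f j bj (ds_map ij x) = f i bi x) ->
    exists h : rhom (A b) N, forall i bi x, h (v b i bi x) = f i bi x.
  move=> fa; have [_ /(_ N (fun i => f (sval i) (proj2_sig i))) []] := SL b.
    by move=> i j ij; apply: rhom_ext => x; exact: fa.
  move=> h [hE _]; exists h => i bi x.
  rewrite -[LHS]/(rhom_comp h (ds_in (exist _ i bi : ds_idx (S b))) x) hE.
  exact: erefl.
have hm b g (bg : le b g) : exists h : rhom (A b) (A g),
    forall i (bi : K b i) (gi : K g i) x, h (v b i bi x) = v g i gi x.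
  have [|h hE] := ind b (A g) (fun i bi => v g i (Kmono _ _ bg _ bi)).
    by move=> i j bi bj ij x; exact: vmap.
  by exists h => i bi gi x; rewrite hE (Prop_irrelevance gi (Kmono _ _ bg _ bi)).
pose m b g bg := sval (cid (hm b g bg)).
have mE b g (bg : le b g) i (bi : K b i) (gi : K g i) x :
    m b g bg (v b i bi x) = v g i gi x.
  exact: (svalP (cid (hm b g bg))).
have hw b : exists h : rhom (A b) M, forall i (bi : K b i) x, h (v b i bi x) = u i x.
  by apply: (ind b M (fun i _ => u i)) => i j _ _ ij x; exact: ua.
have mid b (bb : le b b) x : m b b bb x = x.
  by have [i [bi [y <-]]] := vsurj b x; rewrite (mE _ _ _ _ _ bi).
have mcomp a b g (ab : le a b) (bg : le b g) (ag : le a g) x :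
    m b g bg (m a b ab x) = m a g ag x.
  have [i [ai [y <-]]] := vsurj a x; have bi := Kmono _ _ ab _ ai.
  have gi := Kmono _ _ bg _ bi.
  by rewrite (mE _ _ _ _ _ bi) (mE _ _ _ _ _ gi) (mE _ _ _ _ _ gi).
exists (@ChainSystem R W le A m mid mcomp), v, (fun b => sval (cid (hw b))).
by split=> // b i bi x; exact: (svalP (cid (hw b))).
Qed.

(** * Coordinates of step functions *)

Section StepCoords.
Context {R : rngType} {W : Type} {le : rel W} (hW : wo le).
Variable bot : W.
Hypothesis botP : forall w, le bot w.
Context {T : Type} {eqv : W -> T -> T -> Prop} (hT : tree le eqv).
Implicit Types (A : chain_system R le) (E : set T) (S : set W).
Local Notation amb A := (@amb R W le T A).
Local Notation is_step := (@is_step R W le T eqv _).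
Local Notation adapted := (@adapted W le bot T eqv).

(** The coordinate maps eps of the decomposition of the group of step functions
    into the values at finitely many nodes. *)
Lemma step_coords E S : adapted E S ->
  exists n (k : 'I_n -> T * W), (forall i, E (k i).1 /\ S (k i).2) /\
  forall A, exists eps : forall i, A (k i).2 -> amb A,
  [/\ forall i y, is_step E S (eps i y),
      forall i y z, eps i (y - z) = eps i y - eps i z,
      forall i y r, eps i (ract y r) = amb_act (eps i y) r,
      forall (x : forall i, A (k i).2) j,
        (\sum_(i < n) eps i (x i)) (k j).1 (k j).2 = x j &
      forall f, is_step E S f -> f = \sum_(i < n) eps i (f (k i).1 (k i).2)].
Proof.
move=> ad; have [n [k [kES kf]]] := step_basis (R := R) hW botP hT ad.
exists n, k; split=> // A.
pose z0 : forall i, A (k i).2 := fun i => 0.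
have heps i (y : A (k i).2) : exists f : amb A, is_step E S f /\
    forall j, f (k j).1 (k j).2 = dfwith z0 y j.
  by have [f [fP _]] := kf A (dfwith z0 y); exists f.
pose eps i y : amb A := sval (cid (heps i y)).
have epsS i y : is_step E S (eps i y) := (svalP (cid (heps i y))).1.
have epsE i y j : eps i y (k j).1 (k j).2 = dfwith z0 y j := (svalP (cid (heps i y))).2 j.
have uniq (f g : amb A) : is_step E S f -> is_step E S g ->
    (forall j, f (k j).1 (k j).2 = g (k j).1 (k j).2) -> f = g.
  move=> fS gS fg; have [h [_ hU]] := kf A (fun j => g (k j).1 (k j).2).
  by rewrite -(hU f) ?(hU g).
have sumE (x : forall i, A (k i).2) j : (\sum_(i < n) eps i (x i)) (k j).1 (k j).2 = x j.
  rewrite amb_sumE (bigD1 j)//= big1 ?addr0; first by rewrite epsE dfwith_in.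
  by move=> i ij; rewrite epsE dfwith_out.
exists eps; split=> //.
- move=> i y z; apply: uniq => //; first exact: is_stepB.
  move=> j; rewrite -[RHS]/(eps i y (k j).1 (k j).2 - eps i z (k j).1 (k j).2) !epsE.
  have [ij|ij] := eqVneq i j; last by rewrite !dfwith_out// subrr.
  by subst j; rewrite !dfwith_in.
- move=> i y r; apply: uniq => //; first exact: is_step_act.
  move=> j; rewrite -[RHS]/(ract (eps i y (k j).1 (k j).2) r) !epsE.
  have [ij|ij] := eqVneq i j; last by rewrite !dfwith_out// ract0l.
  by subst j; rewrite !dfwith_in.
- move=> f fS; apply: uniq => //; first exact: is_step_sum.
  by move=> j; rewrite sumE.
Qed.

End StepCoords.

(** * Modules of step functions *)

Section TreeModule.
Context {R : rngType} {W : Type} {le : rel W} (hW : wo le).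
Variable bot : W.
Hypothesis botP : forall w, le bot w.
Context {T : Type} {eqv : W -> T -> T -> Prop} (hT : tree le eqv).
Implicit Types (A : chain_system R le) (E : set T) (S : set W).
Local Notation amb A := (@amb R W le T A).
Local Notation is_step := (@is_step R W le T eqv _).
Local Notation adapted := (@adapted W le bot T eqv).

Lemma step_unitary A E S (f : amb A) : adapted E S -> is_step E S f ->
  exists s : seq (amb A * R),
    {in s, forall p, is_step E S p.1} /\ f = \sum_(p <- s) amb_act p.1 p.2.
Proof.
move=> ad fS; have [n [k [_ /(_ A) [eps [epsS epsB eps_act _ epsf]]]]] :=
  step_coords (R := R) hW botP hT ad.
have eps0 i : eps i 0 = 0 by rewrite -(subrr 0) epsB subrr.
have epsD i y z : eps i (y + z) = eps i y + eps i z.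
  by rewrite -{1}[z]opprK epsB -[- z]sub0r epsB eps0 sub0r opprK.
pose t i := sval (cid (ract_unitary (f (k i).1 (k i).2))).
have tE i : f (k i).1 (k i).2 = \sum_(p <- t i) ract p.1 p.2 := svalP (cid (ract_unitary _)).
exists (flatten [seq [seq (eps i p.1, p.2) | p <- t i] | i <- enum 'I_n]); split.
  by move=> p /flattenP [_ /mapP [i _ ->] /mapP [q _ ->]]; exact: epsS.
rewrite {1}(epsf f fS) big_flatten big_map -[LHS]big_enum /=.
apply: eq_bigr => i _; rewrite {1}(tE i) (big_morph _ (epsD i) (eps0 i)) big_map.
by apply: eq_bigr => p _; rewrite eps_act.
Qed.

(** Directed families of pairs of a finite set of branches and of a finite set
    of levels. *)
Record good (Q : set T -> set W -> Prop) : Prop := Good {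
  good_ad : forall E S, Q E S -> adapted E S;
  good_ne : exists E S, Q E S;
  good_dir : forall E S E' S', Q E S -> Q E' S' -> exists E'' S'',
    [/\ Q E'' S'', E `<=` E'' /\ E' `<=` E'' & S `<=` S'' /\ S' `<=` S'']
}.

(** The family consisting of one pair. *)
Definition single E S : set T -> set W -> Prop := fun E' S' => E' = E /\ S' = S.

Lemma good_single E S : adapted E S -> good (single E S).
Proof.
move=> ad; split.
- by move=> E' S' [-> ->].
- by exists E, S.
- by move=> _ _ _ _ [-> ->] [-> ->]; exists E, S; split; split.
Qed.

Lemma good_adapted : good adapted.
Proof.
split=> //.
- have [S ad _] := adapted_ex hW bot hT (finite_set0 T) (finite_set0 W).
  by exists set0, S.
- move=> E S E' S' [Ef Sf _ _] [Ef' Sf' _ _].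
  have [||S'' ad SS] := @adapted_ex W le hW bot T eqv hT (E `|` E') (S `|` S').
  + by rewrite finite_setU.
  + by rewrite finite_setU.
  exists (E `|` E'), S''; split=> //; split=> x ?; apply: SS; [by left|by right].
Qed.

Section TreeMod.
Variables (A : chain_system R le) (Q : set T -> set W -> Prop) (hQ : good Q).

(** The step functions over some pair of the family Q. *)
Definition stepQ (f : amb A) : Prop := exists E S, Q E S /\ is_step E S f.

Lemma stepQ0 : stepQ 0.
Proof. by have [E [S ES]] := good_ne hQ; exists E, S; split=> //; exact: is_step0. Qed.

Lemma stepQ_mono E S E' S' (f : amb A) : Q E' S' -> E `<=` E' -> S `<=` S' ->
  is_step E S f -> is_step E' S' f.
Proof. by move=> /(good_ad hQ) ad; exact: (is_step_mono hT ad). Qed.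

Lemma stepQB f g : stepQ f -> stepQ g -> stepQ (f - g).
Proof.
move=> [E [S [ES fS]]] [E' [S' [ES' gS]]].
have [E'' [S'' [ES'' [EE EE'] [SS SS']]]] := good_dir hQ ES ES'.
exists E'', S''; split=> //; apply: is_stepB; first exact: (stepQ_mono ES'' EE SS).
exact: (stepQ_mono ES'' EE' SS').
Qed.

Lemma stepQ_act f r : stepQ f -> stepQ (amb_act f r).
Proof. by move=> [E [S [ES fS]]]; exists E, S; split=> //; exact: is_step_act. Qed.

Lemma stepQ_unitary f : stepQ f -> exists s : seq (amb A * R),
  {in s, forall p, stepQ p.1} /\ f = \sum_(p <- s) amb_act p.1 p.2.
Proof.
move=> [E [S [ES fS]]]; have [s [sP ->]] := step_unitary (good_ad hQ ES) fS.
by exists s; split=> // p ps; exists E, S; split=> //; exact: sP.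
Qed.

Lemma amb_actA (f : amb A) r s : amb_act f (rngmul r s) = amb_act (amb_act f r) s.
Proof. by apply: amb_ext => x b; exact: ractA. Qed.
Lemma amb_actDl (f g : amb A) r : amb_act (f + g) r = amb_act f r + amb_act g r.
Proof. by apply: amb_ext => x b; exact: ractDl. Qed.
Lemma amb_actDr (f : amb A) r s : amb_act f (r + s) = amb_act f r + amb_act f s.
Proof. by apply: amb_ext => x b; exact: ractDr. Qed.

Definition tree_data : submod_data R :=
  @SubmodData R (amb A) (@amb_act _ _ _ _ A) stepQ amb_actA amb_actDl amb_actDr
    stepQ0 stepQB stepQ_act stepQ_unitary.

(** The module of step functions. *)
Definition tree_mod : rmodType R := submod tree_data.

(** The function underlying an element of the module of step functions. *)
Definition tree_fun (f : tree_mod) : amb A := smval f.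

Lemma tree_funP (f : tree_mod) : stepQ (tree_fun f). Proof. exact: (smP f). Qed.

Lemma tree_fun_inj (f g : tree_mod) : (forall x b, tree_fun f x b = tree_fun g x b) -> f = g.
Proof. by move=> fg; apply: smval_inj; exact: amb_ext. Qed.

(** A step function as an element of the module. *)
Definition mk_tree (f : amb A) (h : stepQ f) : tree_mod := @mk_submod R tree_data f h.

Lemma tree_funB (f g : tree_mod) x b : tree_fun (f - g) x b = tree_fun f x b - tree_fun g x b.
Proof. by rewrite /tree_fun (smvalB f g). Qed.

Lemma tree_fun_sum I (s : seq I) (F : I -> tree_mod) :
  tree_fun (\sum_(i <- s) F i) = \sum_(i <- s) tree_fun (F i).
Proof.
elim: s => [|i s IHs]; first by rewrite !big_nil.
by rewrite !big_cons -IHs; exact: (smvalD (F i)).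
Qed.

Lemma tree_fun_act (f : tree_mod) r x b : tree_fun (ract f r) x b = ract (tree_fun f x b) r.
Proof. by []. Qed.

Lemma tree_fun0 x b : tree_fun 0 x b = 0.
Proof. by rewrite -(subrr (0 : tree_mod)) tree_funB subrr. Qed.

End TreeMod.

(** The levelwise application of homomorphisms. *)
Definition amb_map A A' (t : forall b, rhom (A b) (A' b)) (f : amb A) : amb A' :=
  fun x b => t b (f x b).

Lemma is_step_map A A' (t : forall b, rhom (A b) (A' b)) E S (f : amb A) :
  (forall b g (bg : le b g) x, ch_map A' bg (t b x) = t g (ch_map A bg x)) ->
  is_step E S f -> is_step E S (amb_map t f).
Proof.
move=> tn [f1 f2 f3]; split; rewrite /amb_map.
- by move=> b x y xy; rewrite (f1 b x y).
- by move=> b x nx; rewrite f2// raddf0.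
- by move=> b g bg x ex sP; rewrite (f3 b g bg)// tn.
Qed.

Section TreeMap.
Variables (A A' : chain_system R le) (Q Q' : set T -> set W -> Prop).
Variables (hQ : good Q) (hQ' : good Q') (t : forall b, rhom (A b) (A' b)).
Hypothesis tP : forall f : amb A, stepQ Q f -> stepQ Q' (amb_map t f).

Definition tree_map_fun (f : tree_mod A hQ) : tree_mod A' hQ' :=
  mk_tree hQ' (tP (tree_funP f)).

Lemma tree_map_is_rhom : is_rhom tree_map_fun.
Proof.
split=> [f g|f r]; apply: tree_fun_inj => x b.
  by rewrite tree_funB -[LHS]/(t b (tree_fun (f - g) x b)) tree_funB raddfB.
by rewrite -[LHS]/(t b (ract (tree_fun f x b) r)) rhom_act.
Qed.

(** The homomorphism of step function modules induced by a levelwise map. *)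
Definition tree_map : rhom (tree_mod A hQ) (tree_mod A' hQ') := mk_rhom tree_map_is_rhom.

End TreeMap.

(** The module of step functions over fixed E and S is a finite direct sum of
    terms of the chain. *)
Lemma tree_mod_single (F : rmodType R -> Prop) A E S (ad : adapted E S) :
  closed_finite_sums F -> (forall b, F (A b)) -> F (tree_mod A (good_single ad)).
Proof.
move=> Fsum FA; have [n [k [_ /(_ A) [eps [epsS epsB eps_act sumE epsf]]]]] :=
  step_coords (R := R) hW botP hT ad.
have epsQ i y : stepQ (single E S) (eps i y) by exists E, S.
pose j i (y : A (k i).2) := mk_tree (good_single ad) (epsQ i y).
have jr i : is_rhom (j i).
  split=> [y z|y r]; apply: smval_inj; first by rewrite smvalB; exact: epsB.
  exact: eps_act.
have jsum x : tree_fun (\sum_(i < n) mk_rhom (jr i) (x i)) = \sum_(i < n) eps i (x i).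
  exact: (tree_fun_sum (index_enum 'I_n) (fun i => mk_rhom (jr i) (x i))).
apply: (Fsum n (fun i => A (k i).2) _ (fun i => mk_rhom (jr i))) => // f.
have fS : is_step E S (tree_fun f) by have [E' [S' [[-> ->]]]] := tree_funP f.
exists (fun i => tree_fun f (k i).1 (k i).2); split.
  by apply: smval_inj; rewrite -/(tree_fun f) {1}(epsf _ fS); exact: esym (jsum _).
move=> x fE; apply: functional_extensionality_dep => i.
by rewrite fE jsum sumE.
Qed.

(** Step functions over E and S are a direct summand of all step functions. *)
Lemma tree_mod_summand A Q (hQ : good Q) E S (ad : adapted E S) (QES : Q E S) :
  exists i : rhom (tree_mod A (good_single ad)) (tree_mod A hQ),
    (forall f, tree_fun (i f) = tree_fun f) /\ summand_embedding i.
Proof.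
have sub (f : amb A) : stepQ (single E S) f -> stepQ Q (amb_map (fun b => rhom_id (A b)) f).
  by move=> [E' [S' [[-> ->] fS]]]; exists E, S.
pose i : rhom (tree_mod A (good_single ad)) (tree_mod A hQ) := tree_map (good_single ad) hQ sub.
exists i; split=> //.
have [n [k [kES /(_ A) [eps [epsS epsB eps_act sumE epsf]]]]] :=
  step_coords (R := R) hW botP hT ad.
pose pr (f : amb A) : amb A := \sum_(i < n) eps i (f (k i).1 (k i).2).
have prS f : is_step E S (pr f) by apply: is_step_sum => j; exact: epsS.
have prk f i0 : pr f (k i0).1 (k i0).2 = f (k i0).1 (k i0).2.
  exact: (sumE (fun i => f (k i).1 (k i).2)).
have prB f g : pr (f - g) = pr f - pr g.
  by rewrite /pr -sumrB; apply: eq_bigr => j _; rewrite -epsB.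
have pr_act f r : pr (amb_act f r) = amb_act (pr f) r.
  apply: amb_ext => x b; rewrite /pr /amb_act !amb_sumE ract_suml.
  by apply: eq_bigr => j _; rewrite eps_act.
have prQ f : stepQ Q (pr f) by exists E, S.
(* The complement consists of the functions that vanish on all the nodes k i. *)
pose P (f : amb A) := stepQ Q f /\ pr f = 0.
have P0 : P 0 by split; [exact: stepQ0|rewrite -(subrr 0) prB !subrr].
have PB f g : P f -> P g -> P (f - g).
  by move=> [fQ f0] [gQ g0]; split; [exact: stepQB|rewrite prB f0 g0 subrr].
have Pact f r : P f -> P (amb_act f r).
  move=> [fQ f0]; split; first exact: stepQ_act.
  by rewrite pr_act f0; apply: amb_ext => x b; exact: ract0l.
have prpr f : pr (pr f) = pr f by rewrite [RHS]/pr; apply: eq_bigr => j _; rewrite prk.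
have Punit f : P f -> exists s : seq (amb A * R),
    {in s, forall p, P p.1} /\ f = \sum_(p <- s) amb_act p.1 p.2.
  move=> [/(stepQ_unitary hQ) [s [sQ fE]] f0].
  exists [seq (p.1 - pr p.1, p.2) | p <- s]; split.
    move=> _ /mapP [p ps ->]; split; first by apply: stepQB => //; exact: sQ.
    by rewrite prB prpr subrr.
  have pr0 : pr 0 = 0 by case: P0.
  have prD g h : pr (g + h) = pr g + pr h.
    by rewrite -{1}[h]opprK prB -[- h]sub0r prB pr0 sub0r opprK.
  have fE' : f = f - pr f by rewrite f0 subr0.
  rewrite fE' {1 2}fE (big_morph pr prD pr0) -sumrB big_map.
  apply: eq_bigr => p _ /=; rewrite pr_act.
  by apply: amb_ext => x b; rewrite /amb_act ractDl ractNl.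
pose sm_Y := @SubmodData R (amb A) (@amb_act _ _ _ _ A) P
  (@amb_actA A) (@amb_actDl A) (@amb_actDr A) P0 PB Pact Punit.
pose Y : rmodType R := submod sm_Y.
pose j (y : Y) : tree_mod A hQ := mk_tree hQ (smP y).1.
have jr : is_rhom j.
  by split=> [y z|y r]; apply: smval_inj => //; rewrite smvalB [RHS]/= -smvalB.
exists Y, (mk_rhom jr) => f.
have hpr : stepQ (single E S) (pr (tree_fun f)) by exists E, S.
have hY : P (tree_fun f - pr (tree_fun f)).
  split; last by rewrite prB prpr subrr.
  by apply: stepQB => //; exact: tree_funP.
have prE g : is_step E S g -> pr g = g by move=> gS; rewrite [RHS](epsf g gS).
exists (mk_tree (good_single ad) hpr, (@mk_submod R sm_Y _ hY : Y)); split.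
  apply: smval_inj; rewrite smvalD /=.
  by rewrite -[X in _ = X + _]/(pr (tree_fun f)) addrC subrK.
move=> [g y] /= fE.
have gS : is_step E S (tree_fun g) by have [E' [S' [[-> ->]]]] := tree_funP g.
have fE' : tree_fun f = tree_fun g + smval y by rewrite fE /tree_fun smvalD.
have gE : tree_fun g = pr (tree_fun f).
  rewrite fE' -[smval y]opprK prB -[- smval y]sub0r prB (smP y).2.
  by rewrite -(subrr 0) prB !subrr subr0 prE.
congr (_, _); apply: smval_inj; first by rewrite /= -gE.
by rewrite /= -gE fE' addrAC subrr add0r.
Qed.

End TreeModule.

(** * Step functions as a direct limit *)

Section TreeLimit.
Context {R : rngType} {W : Type} {le : rel W} (hW : wo le).
Variable bot : W.
Hypothesis botP : forall w, le bot w.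
Context {T : Type} {eqv : W -> T -> T -> Prop} (hT : tree le eqv).
Variables (D : direct_system R) (K : W -> set (ds_idx D)).
Hypothesis Kmono : forall b g, le b g -> K b `<=` K g.
Hypothesis K0 : forall b, K b !=set0.
Hypothesis Kdir : forall b i j, K b i -> K b j ->
  exists k, [/\ K b k, (i <= k)%O & (j <= k)%O].
Implicit Types (E : set T) (S : set W).
Local Notation amb A := (@amb R W le T A).
Local Notation is_step := (@is_step R W le T eqv _).
Local Notation adapted := (@adapted W le bot T eqv).

(** Increasing choices of an index in each K b that are constant between two
    consecutive levels of S. *)
Record iota_ok S (io : W -> ds_idx D) : Prop := IotaOk {
  io_K : forall b, K b (io b);
  io_mono : forall b g, le b g -> (io b <= io g)%O;
  io_const : forall b g, le b g -> (forall s, S s -> le s g -> le s b) -> io b = io g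
}.

Lemma iota_ex S (r : W -> ds_idx D) : finite_set S -> S bot -> (forall b, K b (r b)) ->
  exists2 io, iota_ok S io & forall b, S b -> (r b <= io b)%O.
Proof.
move=> Sfin S0 rK; have [s Ss] := finite_set_seq Sfin.
have [n sn] : exists n, (size s <= n)%N by exists (size s).
elim: n S s Sfin S0 Ss sn => [|n IHn] S s Sfin S0 Ss sn.
  by move: sn S0; rewrite leqn0 size_eq0 => /eqP s0 /Ss; rewrite s0.
have [m Sm mm] := finite_max hW Sfin (ex_intro _ bot S0).
have [mbot|mbot] := pselect (m = bot).
  subst m; have Sbot b : S b -> b = bot by move=> /mm bb; exact: (wo_anti hW).
  exists (fun=> r bot); last by move=> b /Sbot ->.
  by split=> // b; apply: (Kmono (botP b)).
have [||||io0 [K0' mono0 const0] rio0] := IHn (S `\ m) [seq x <- s | x != (m : {classic W})].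
- by apply: finite_setD.
- by split=> //= bm; apply: mbot.
- move=> x; rewrite mem_filter; split.
    by move=> [/Ss -> /= xm]; rewrite andbT; apply/eqP.
  by move=> /andP[/eqP xm /Ss Sx]; split.
- have : (count (predC1 (m : {classic W})) s < size s)%N.
    rewrite -(count_predC (pred1 (m : {classic W})) s) -[X in (X < _)%N]add0n ltn_add2r.
    by rewrite -has_count has_pred1; apply/Ss.
  by rewrite size_filter => /leq_trans/(_ sn).
have [j [Kj io0j rj]] := Kdir (K0' m) (rK m).
exists (fun g => if le m g then j else io0 g).
  split.
  - by move=> b; case: ifP => [mb|_]; [exact: (Kmono mb)|exact: K0'].
  - move=> b g bg; case: ifP => mb; first by rewrite (wo_trans hW mb bg).
    case: ifP => mg; last exact: mono0.
    apply: le_trans io0j; apply: mono0.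
    by case: (wo_total hW b m) => // mb'; rewrite mb' in mb.
  - move=> b g bg sP; case: ifP => mb; first by rewrite (wo_trans hW mb bg).
    case: ifP => mg; first by have := sP m Sm mg; rewrite mb.
    by apply: const0 => // s' [Ss' _]; exact: sP.
move=> b Sb; case: ifP => mb.
  by have <- : m = b by apply: (wo_anti hW mb); exact: mm.
by apply: rio0; split=> //= bm; subst b; rewrite (wo_refl hW) in mb.
Qed.

(** Two choices for subsets of S are dominated by one for S, which can also be
    made to dominate given indices at the levels of S. *)
Lemma iota_ub S1 S2 S io1 io2 (r : W -> ds_idx D) :
  finite_set S -> S bot -> S1 `<=` S -> S2 `<=` S ->
  iota_ok S1 io1 -> iota_ok S2 io2 -> (forall b, K b (r b)) ->
  exists2 io, iota_ok S io & [/\ forall b, (io1 b <= io b)%O,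
    forall b, (io2 b <= io b)%O & forall b, S b -> (r b <= io b)%O].
Proof.
move=> Sfin S0 S1S S2S [K1 mono1 const1] [K2 mono2 const2] rK.
have h b : exists k, [/\ K b k, (io1 b <= k)%O, (io2 b <= k)%O & (r b <= k)%O].
  have [k [Kk k1 k2]] := Kdir (K1 b) (K2 b); have [l [Kl l1 l2]] := Kdir Kk (rK b).
  by exists l; split=> //; [exact: le_trans k1 l1|exact: le_trans k2 l1].
have [r' r'P] := choice h.
have [|io ioP rio] := @iota_ex S r' Sfin S0; first by move=> b; case: (r'P b).
exists io => //; split.
- move=> g; have [b [Sb bg bm]] := last_level hW botP g Sfin S0.
  rewrite -(const1 b g bg); last by move=> s /S1S; exact: bm.
  rewrite -(io_const ioP bg bm); apply: le_trans (rio b Sb); by case: (r'P b).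
- move=> g; have [b [Sb bg bm]] := last_level hW botP g Sfin S0.
  rewrite -(const2 b g bg); last by move=> s /S2S; exact: bm.
  rewrite -(io_const ioP bg bm); apply: le_trans (rio b Sb); by case: (r'P b).
- by move=> b Sb; apply: le_trans (rio b Sb); case: (r'P b).
Qed.

Lemma chain_of_id (io : W -> ds_idx D) (mono : forall b g, le b g -> (io b <= io g)%O)
  b (bb : le b b) x : ds_map (mono b b bb) x = x.
Proof. exact: ds_map_id. Qed.

Lemma chain_of_comp (io : W -> ds_idx D) (mono : forall b g, le b g -> (io b <= io g)%O)
  a b g (ab : le a b) (bg : le b g) (ag : le a g) x :
  ds_map (mono b g bg) (ds_map (mono a b ab) x) = ds_map (mono a g ag) x.
Proof. exact: ds_map_comp. Qed.

(** The chain of the terms of D selected by io. *)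
Definition chain_of S io (h : iota_ok S io) : chain_system R le :=
  @ChainSystem R W le (fun b => D (io b)) (fun b g bg => ds_map (io_mono h bg))
    (chain_of_id (io_mono h)) (chain_of_comp (io_mono h)).

Local Notation good := (@good W le bot T eqv).
Local Notation stepQ := (@stepQ R W le T eqv _).
Local Notation tree_mod := (@tree_mod R W le hW bot botP T eqv hT).

Section Sys.
Variables (Q : set T -> set W -> Prop) (hQ : good Q).

(** The indices consist of a pair E, S from Q and of a choice io for S. *)
Record tree_idx_ok (p : set T * set W * (W -> ds_idx D)) : Prop := TreeIdxOk {
  ti_Q : Q p.1.1 p.1.2;
  ti_ok : iota_ok p.1.2 p.2
}.

Definition tree_idx : Type := {p | tree_idx_ok p}.

Definition ti_E (p : tree_idx) := (proj1_sig p).1.1.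
Definition ti_S (p : tree_idx) := (proj1_sig p).1.2.
Definition ti_io (p : tree_idx) := (proj1_sig p).2.

Lemma ti_QP (p : tree_idx) : Q (ti_E p) (ti_S p).
Proof. exact: ti_Q (proj2_sig p). Qed.

Lemma ti_ad (p : tree_idx) : adapted (ti_E p) (ti_S p).
Proof. exact (good_ad hQ (ti_QP p)). Qed.

Lemma ti_ioP (p : tree_idx) : iota_ok (ti_S p) (ti_io p).
Proof. exact: ti_ok (proj2_sig p). Qed.

Definition mk_ti E S io (ES : Q E S) (h : iota_ok S io) : tree_idx :=
  exist _ (E, S, io) (@TreeIdxOk (E, S, io) ES h).

(** The order is inclusion of E and of S, and the pointwise order on choices. *)
Definition tree_idx_le (p q : tree_idx) : Prop :=
  [/\ ti_E p `<=` ti_E q, ti_S p `<=` ti_S q &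
      forall b, (ti_io p b <= ti_io q b)%O].

Lemma tree_idx_le_refl p : tree_idx_le p p.
Proof. by split=> // b; exact: lexx. Qed.

Lemma tree_idx_le_anti p q : tree_idx_le p q -> tree_idx_le q p -> p = q.
Proof.
case: p q => [[[E S] io] hp] [[[E' S'] io'] hq] [/= EE SS ii] [/= EE' SS' ii'].
apply: sval_inj => /=; congr (_, _, _); try by apply/seteqP.
by apply/funext => b; apply/eqP; rewrite eq_le; apply/andP; split; [exact: ii|exact: ii'].
Qed.

Lemma tree_idx_le_trans q p r : tree_idx_le p q -> tree_idx_le q r -> tree_idx_le p r.
Proof.
move=> [EE SS ii] [EE' SS' ii']; split=> [x /EE/EE'//|x /SS/SS'//|b].
exact: le_trans (ii b) (ii' b).
Qed.

Definition tree_order : prop_order :=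
  PropOrder tree_idx_le_refl tree_idx_le_anti tree_idx_le_trans.

Lemma tree_le_io (p q : tree_idx) : tree_idx_le p q -> forall b, (ti_io p b <= ti_io q b)%O.
Proof. by case. Qed.

(** The step functions over E and S with values in the terms chosen by io. *)
Definition tree_obj (p : tree_idx) : rmodType R :=
  tree_mod (chain_of (ti_ioP p)) (good_single (ti_ad p)).

Definition tree_tr (p q : tree_idx) (pq : tree_idx_le p q) b :
    rhom (chain_of (ti_ioP p) b) (chain_of (ti_ioP q) b) :=
  ds_map (tree_le_io pq b).

Lemma tree_tr_stepQ (p q : tree_idx) (pq : tree_idx_le p q)
    (f : amb (chain_of (ti_ioP p))) :
  stepQ (single (ti_E p) (ti_S p)) f ->
  stepQ (single (ti_E q) (ti_S q)) (amb_map (tree_tr pq) f).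
Proof.
move=> [E [S [[-> ->] fS]]]; exists (ti_E q), (ti_S q); split=> //.
have [EE SS ii] := pq; apply: (is_step_mono hT (ti_ad q) EE SS).
apply: is_step_map fS => b g bg x.
have bg' : (ti_io p b <= ti_io q g)%O.
  by apply: le_trans (ii b) _; exact: (io_mono (ti_ioP q) bg).
by rewrite /tree_tr /= !(ds_map_comp _ _ bg').
Qed.

Definition tree_map_idx (p q : tree_idx) (pq : tree_idx_le p q) :
    rhom (tree_obj p) (tree_obj q) :=
  tree_map hW botP hT (good_single (ti_ad p)) (good_single (ti_ad q)) (tree_tr_stepQ pq).

Lemma tree_directed (p q : po_type tree_order) : exists r, (p <= r)%O /\ (q <= r)%O.
Proof.
have [E [S [ES [pE qE] [pS qS]]]] := good_dir hQ (ti_QP p) (ti_QP q).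
have [_ Sfin S0 _] := good_ad hQ ES.
have [io ioP [pio qio _]] :=
  iota_ub Sfin S0 pS qS (ti_ioP p) (ti_ioP q) (io_K (ti_ioP p)).
by exists (mk_ti ES ioP : po_type tree_order); split; apply/po_typeP.
Qed.

Lemma tree_inhabited : inhabited (po_type tree_order).
Proof.
have [E [S ES]] := good_ne hQ; have [_ Sfin S0 _] := good_ad hQ ES.
have [r rK] := choice K0; have [io ioP _] := iota_ex Sfin S0 rK.
by constructor; exact: mk_ti ES ioP.
Qed.

(** The direct system of these modules, with the pointwise transition maps. *)
Definition tree_system : direct_system R.
Proof.
refine (@DirectSystem R _ (po_type tree_order) tree_inhabited tree_directed
  tree_obj (fun p q pq => tree_map_idx (elimT (po_typeP p q) pq)) _ _).
- move=> p pp x; apply: tree_fun_inj => y b; exact: ds_map_id.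
- move=> p q r pq qr pr x; apply: tree_fun_inj => y b; exact: ds_map_comp.
Defined.

Lemma tree_system_in (F : rmodType R -> Prop) : closed_finite_sums F ->
  (forall i, F (D i)) -> forall p, F (tree_system p).
Proof. by move=> Fsum DF p; apply: tree_mod_single => // b; exact: DF. Qed.

Variables (A : chain_system R le) (v : forall b i, K b i -> rhom (D i) (A b)).
Hypothesis vmap : forall b g (bg : le b g) i (bi : K b i) (gi : K g i) x,
  ch_map A bg (v bi x) = v gi x.
Hypothesis vtrans : forall b i j (bi : K b i) (bj : K b j) (ij : (i <= j)%O) x,
  v bj (ds_map ij x) = v bi x.
Hypothesis vsurj : forall b y, exists i (bi : K b i) x, v bi x = y.
Hypothesis vker : forall b i (bi : K b i) x, v bi x = 0 ->
  exists j (ij : (i <= j)%O), K b j /\ ds_map ij x = 0.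

Definition tree_in_tr (p : tree_idx) b : rhom (chain_of (ti_ioP p) b) (A b) :=
  v (io_K (ti_ioP p) b).

Lemma tree_in_stepQ (p : tree_idx) (f : amb (chain_of (ti_ioP p))) :
  stepQ (single (ti_E p) (ti_S p)) f -> stepQ Q (amb_map (tree_in_tr p) f).
Proof.
move=> [E [S [[-> ->] fS]]]; exists (ti_E p), (ti_S p); split; first exact: ti_QP.
apply: is_step_map fS => b g bg x; rewrite /tree_in_tr /=.
have gb : K g (ti_io p b) by apply: (Kmono bg); exact: (io_K (ti_ioP p)).
by rewrite (vmap _ _ gb) (vtrans gb).
Qed.

(** The cocone given by the pointwise maps to the limits A b. *)
Definition tree_in (p : tree_idx) : rhom (tree_obj p) (tree_mod A hQ) :=
  tree_map hW botP hT (good_single (ti_ad p)) hQ (tree_in_stepQ (p := p)).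

(** The step functions with values in the chain of direct limits form the
    direct limit of the step functions with values in terms of D. *)
Lemma tree_limit : is_direct_limit (D := tree_system) tree_in.
Proof.
apply: direct_limit_of_germs.
- move=> p q pq f; apply: tree_fun_inj => x b; exact: vtrans.
- move=> f; have [E [S [ES fS]]] := tree_funP f.
  have ad := good_ad hQ ES; have [Efin Sfin S0 _] := ad.
  have [sE EP] := finite_set_seq Efin.
  have hr b : exists i, exists bi : K b i, forall e, E e -> exists x, v bi x = tree_fun f e b.
    have : exists i, exists bi : K b i, forall e : {classic T}, e \in sE ->
        exists x, v bi x = tree_fun f e b.
      elim: sE {EP} => [|e s [i [bi IHs]]]; first by have [i bi] := K0 b; exists i, bi.
      have [j [bj [x xE]]] := vsurj (tree_fun f e b).
      have [k [bk ik jk]] := Kdir bi bj; exists k, bk => e'.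
      rewrite inE => /orP[/eqP ->|/IHs [y yE]]; last by exists (ds_map ik y); rewrite (vtrans bi).
      by exists (ds_map jk x); rewrite (vtrans bj).
    by move=> [i [bi h]]; exists i, bi => e /EP; exact: h.
  have [r rP] := choice hr.
  have [|io ioP rio] := @iota_ex S r Sfin S0; first by move=> b; have [] := rP b.
  pose p := mk_ti ES ioP.
  have gE b : exists h : A b -> D (io b), forall e, E e -> S b ->
      v (io_K ioP b) (h (tree_fun f e b)) = tree_fun f e b.
    have hx (y : A b) : exists x, (exists x', v (io_K ioP b) x' = y) -> v (io_K ioP b) x = y.
      by have [[x <-]|no] := pselect (exists x, v (io_K ioP b) x = y); [exists x|exists 0].
    exists (fun y => sval (cid (hx y))) => e Ee Sb.
    apply: (svalP (cid (hx (tree_fun f e b)))).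
    have [rb /(_ e Ee) [x xE]] := rP b.
    by exists (ds_map (rio b Sb) x); rewrite (vtrans rb).
  pose c : amb (chain_of (ti_ioP p)) := fun e b => sval (cid (gE b)) (tree_fun f e b).
  have [f1 _ _] := fS.
  have [|g gS gc] := @step_ext R W le hW bot botP T eqv hT (chain_of (ti_ioP p)) E S c ad.
    by move=> e e' b Ee Ee' Sb ee'; rewrite /c (f1 b e e').
  have gQ : stepQ (single (ti_E p) (ti_S p)) g by exists E, S.
  exists (p : po_type tree_order), (mk_tree hW botP hT (good_single (ti_ad p)) gQ).
  apply: smval_inj; rewrite -[RHS]/(tree_fun f).
  apply: (step_eq hW botP hT ad) => //; last first.
    move=> e b Ee Sb; rewrite -[LHS]/(v (io_K (ti_ioP p) b) (g e b)) gc//.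
    rewrite -[RHS](svalP (cid (gE b)) e Ee Sb) /c.
    by congr (v _ _); exact: Prop_irrelevance.
  have : is_step E S g by [].
  apply: is_step_map => b b' bb' x; rewrite /tree_in_tr /=.
  have gb : K b' (ti_io p b) by apply: (Kmono bb'); exact: (io_K (ti_ioP p)).
  by rewrite (vmap _ _ gb) (vtrans gb).
- move=> p f f0; have ad := ti_ad p; have [Efin Sfin S0 _] := ad.
  have fS : is_step (ti_E p) (ti_S p) (tree_fun f).
    by have [E [S [[-> ->]]]] := tree_funP f.
  have fv e b : v (io_K (ti_ioP p) b) (tree_fun f e b) = 0.
    by rewrite -[LHS]/(tree_fun (tree_in p f) e b) f0 tree_fun0.
  have [sE EP] := finite_set_seq Efin.
  have hr b : exists i, K b i /\ exists ii : (ti_io p b <= i)%O,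
      forall e, ti_E p e -> ds_map ii (tree_fun f e b) = 0.
    have : exists i, K b i /\ exists ii : (ti_io p b <= i)%O,
        forall e : {classic T}, e \in sE -> ds_map ii (tree_fun f e b) = 0.
      elim: sE {EP} => [|e s [i [bi [ii IHs]]]].
        by exists (ti_io p b); split; [exact: (io_K (ti_ioP p))|exists (lexx _)].
      have [j [ij [bj je]]] := vker (fv e b).
      have [k [bk ik jk]] := Kdir bi bj; exists k; split=> //; exists (le_trans ii ik) => e'.
      rewrite inE => /orP[/eqP ->|/IHs e0]; last first.
        by rewrite -(ds_map_comp ii ik) e0 raddf0.
      rewrite (bool_irrelevance (le_trans ii ik) (le_trans ij jk)) -(ds_map_comp ij jk).
      by rewrite [X in ds_map _ X]je raddf0.
    by move=> [i [bi [ii h]]]; exists i; split=> //; exists ii => e /EP; exact: h.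
  have [r rP] := choice hr.
  have [|io ioP [pio _ rio]] := @iota_ub (ti_S p) (ti_S p) (ti_S p) (ti_io p) (ti_io p) r
     Sfin S0 (fun _ h => h) (fun _ h => h) (ti_ioP p) (ti_ioP p).
    by move=> b; case: (rP b).
  pose q := mk_ti (ti_QP p) ioP.
  have pq : tree_idx_le p q by split.
  exists (q : po_type tree_order), (introT (po_typeP (p : po_type tree_order) q) pq).
  apply: smval_inj; apply: (step_eq hW botP hT (ti_ad q)).
  + set g := ds_map _ _; by have [E [S [[-> ->]]]] := tree_funP (g : tree_obj q).
  + exact: is_step0.
  + move=> e b Ee Sb.
    have [_ [ii /(_ e Ee) e0]] := rP b.
    rewrite -[LHS]/(ds_map _ (tree_fun f e b)).
    have rb := rio b Sb.
    set le1 := tree_le_io _ _.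
    rewrite (bool_irrelevance le1 (le_trans ii rb)) -(ds_map_comp ii rb).
    by rewrite [X in ds_map _ X]e0 raddf0.
Qed.

End Sys.

(** The system attached to fixed E and S is small. *)
Lemma tree_idx_small theta E S (ad : adapted E S) : emb nat theta ->
  (forall b, small theta {i | K b i}) -> small theta (tree_idx (single E S)).
Proof.
move=> theta_inf Ks; have [_ Sfin S0 _] := ad.
have [s Ss] := finite_set_seq Sfin.
have [m Sm mm] := finite_max hW Sfin (ex_intro _ bot S0).
have := @small_list theta theta_inf W {i | K m i} s
  (fun g => forall b b', le b b' -> (forall s, S s -> le s b' -> le s b) -> g b = g b').
move=> /(_ _ (Ks m)) sm; apply: small_emb (sm _); last first.
  move=> f g fP gP fg; apply/funext => b'.
  have [b [Sb bb' bm]] := last_level hW botP b' Sfin S0.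
  by rewrite -(fP b b')// -(gP b b')// fg//; apply/Ss.
have h (p : tree_idx (single E S)) b : K m (ti_io p b).
  have [b' [Sb' bb' bm]] := last_level hW botP b Sfin S0.
  have [_ SE] := ti_QP p.
  rewrite -(io_const (ti_ioP p) bb'); last by rewrite SE.
  by apply: (Kmono (mm b' Sb')); exact: (io_K (ti_ioP p)).
have hP (p : tree_idx (single E S)) b b' : le b b' ->
    (forall s, S s -> le s b' -> le s b) ->
    exist (K m) (ti_io p b) (h p b) = exist (K m) (ti_io p b') (h p b').
  move=> bb' bm; apply: sval_inj => /=; apply: (io_const (ti_ioP p)) => //.
  by have [_ ->] := ti_QP p.
exists (fun p => exist _ (fun b => exist (K m) (ti_io p b) (h p b)) (hP p)).
move=> p q /(congr1 sval) /= pq; apply: tree_idx_le_anti.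
all: have [EE SS] := ti_QP p; have [EE' SS'] := ti_QP q; split.
all: rewrite ?EE ?EE' ?SS ?SS'//.
all: move=> b; have [->] := congr1 (fun f => f b) pq; exact: lexx.
Qed.

End TreeLimit.

(** * A tree with very many branches *)

Section Codes.
Context {W : Type} {le : rel W} (hW : wo le) (G K : Type).

(** The labels available at level b are the families of functions from G to K
    indexed by the sequences of labels at the levels below b. Branches being
    sequences of labels at all levels, such a family is a single step of a
    branch. *)
Fixpoint label b (a : Acc (fun x y => ~~ le y x) b) {struct a} : Type :=
  match a with
  | Acc_intro f => (forall g (h : ~~ le b g), label (f g h)) -> G -> K
  end.

Definition lab b : Type := label (wo_wf hW b).

Lemma label_code b (a : Acc (fun x y => ~~ le y x) b) :
  exists code : ((forall g, ~~ le b g -> lab g) -> G -> K) -> label a, injective code.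
Proof.
case: a => f /=; have -> : f = (fun g h => wo_wf hW g).
  apply: functional_extensionality_dep => g.
  by apply: functional_extensionality_dep => h; exact: Prop_irrelevance.
by exists id.
Qed.

End Codes.

(** There is a tree with an injective coding, by single branches, of the
    families c whose member c b assigns a function from G to K to each branch,
    depending only on the part of the branch below level b. *)
Lemma exists_coding_tree W (le : rel W) (hW : wo le) (G K : Type) (k0 : K) :
  exists (T : Type) (eqv : W -> T -> T -> Prop) (code : (W -> T -> G -> K) -> T),
    tree le eqv /\
    let path_inv (c : W -> T -> G -> K) :=
      forall b x y, (forall g, ~~ le b g -> eqv g x y) -> c b x = c b y in
    forall c c', path_inv c -> path_inv c' -> code c = code c' -> c = c'.
Proof.
pose lb := @lab W le hW G K.
have hc b : exists code : ((forall g, ~~ le b g -> lb g) -> G -> K) -> lb b, injective code.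
  exact: label_code.
pose cd b := sval (cid (hc b)).
have cdI b : injective (cd b) := svalP (cid (hc b)).
pose T := forall b, lb b.
pose eqv b (x y : T) := forall g, le g b -> x g = y g.
pose dflt : T := fun b => cd b (fun _ _ => k0).
pose ext b (p : forall g, ~~ le b g -> lb g) : T := fun g =>
  match pselect (~~ le b g) with left h => p g h | right _ => dflt g end.
exists T, eqv, (fun c b => cd b (fun p => c b (ext b p))); split.
  split.
  - by [].
  - by move=> b x y xy g gb; rewrite xy.
  - by move=> b x y z xy yz g gb; rewrite xy// yz.
  - by move=> b g x y bg xy a ab; apply: xy; exact: (wo_trans hW ab).
  - move=> x y xy; apply: contrapT => /forallNP no; apply: xy.
    apply: functional_extensionality_dep => b.
    by have /contrapT := no b; apply; exact: (wo_refl hW).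
move=> pinv c c' cP c'P cc'; apply/funext => b; apply/funext => x.
have /(congr1 (fun t => t b)) /cdI := cc'.
move=> /(congr1 (fun f => f (fun g _ => x g))) e.
have xE g : ~~ le b g -> eqv g x (ext b (fun g _ => x g)).
  move=> bg g' g'g; rewrite /ext; case: pselect => // n; exfalso; apply: n.
  by apply: contra bg => bg'; exact: (wo_trans hW bg').
by rewrite (cP b _ _ xE) (c'P b _ _ xE).
Qed.

(** There are more predicates on T than elements, by the diagonal argument. *)
Lemma cantor_pred T (f : (T -> bool) -> T) : exists g g', g <> g' /\ f g = f g'.
Proof.
pose d x := `[< exists g, f g = x /\ ~~ g x >].
case: (boolP (d (f d))) => [dd|nd].
  have /asboolP [g [gd ng]] := dd; exists g, d; split=> // E; subst g.
  by rewrite dd in ng.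
by exfalso; move/negP: (nd); apply; apply/asboolP; exists d.
Qed.

(** * Two splitting tools *)

Lemma fsum_list (T : choiceType) (V : zmodType) (F : T -> V) (r : seq T) : uniq r ->
  (forall x, x \notin r -> F x = 0) -> \sum_(x \in [set: T]) F x = \sum_(x <- r) F x.
Proof.
move=> ur F0; rewrite (fsbigE r)//; last by move=> i _; exact: F0.
by apply: eq_bigl => x; rewrite in_setT.
Qed.

(** A colimit of a chain has the usual universal property. *)
Lemma chain_induced (R : rngType) W (le : rel W) (hW : wo le) (w0 : W)
    (A : chain_system R le) (M N : rmodType R) (w : forall b, rhom (A b) M)
    (t : forall b, rhom (A b) N) :
  (forall b g (bg : le b g) x, w g (ch_map A bg x) = w b x) ->
  (forall y, exists b x, w b x = y) ->
  (forall b x, w b x = 0 -> exists g (bg : le b g), ch_map A bg x = 0) ->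
  (forall b g (bg : le b g) x, t g (ch_map A bg x) = t b x) ->
  exists s : rhom M N, forall b x, s (w b x) = t b x.
Proof.
move=> wa wsurj wker ta.
pose po := @PropOrder W (fun x y => le x y) (wo_refl hW) (wo_anti hW)
  (fun y x z => @wo_trans _ _ hW y x z).
have dir (i j : po_type po) : exists k, (i <= k)%O /\ (j <= k)%O.
  have [ij|ji] := wo_total hW i j.
    by exists j; split; apply/po_typeP => //; exact: (wo_refl hW).
  by exists i; split; apply/po_typeP => //; exact: (wo_refl hW).
pose D := @DirectSystem R _ (po_type po) (inhabits w0) dir (fun b => A b)
  (fun i j ij => ch_map A (elimT (po_typeP i j) ij))
  (fun i ii x => ch_map_id _ x) (fun i j k ij jk ik x => ch_map_comp _ _ _ x).
have [||| _ /(_ N t) []] := @direct_limit_of_germs R D M w.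
- by move=> i j ij x; exact: wa.
- exact: wsurj.
- move=> i y /wker [g [bg e]]; exists g, (introT (po_typeP (i : po_type po) g) bg).
  by rewrite -[RHS]e /=; congr (ch_map A _ y); exact: bool_irrelevance.
- by move=> i j ij; apply: rhom_ext => x; exact: ta.
- by move=> s [sE _]; exists s => b x; rewrite -[LHS]/(rhom_comp s (w b) x) sE.
Qed.

(** A section of a homomorphism embeds a direct summand. *)
Lemma retract_summand (R : rngType) (M N : rmodType R) (s : rhom M N) (f : rhom N M) :
  (forall x, f (s x) = x) -> summand_embedding s.
Proof.
move=> fs; pose P (n : N) := f n = 0.
have P0 : P 0 by rewrite /P raddf0.
have PB x y : P x -> P y -> P (x - y) by rewrite /P raddfB /= => -> ->; rewrite subr0.
have Pact x r : P x -> P (ract x r) by rewrite /P rhom_act => ->; exact: ract0l.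
have Punit x : P x -> exists l : seq (N * R),
    {in l, forall p, P p.1} /\ x = \sum_(p <- l) ract p.1 p.2.
  move=> Px; have [l xE] := ract_unitary x.
  exists [seq (p.1 - s (f p.1), p.2) | p <- l]; split.
    by move=> _ /mapP [p _ ->]; rewrite /P /= raddfB /= fs subrr.
  have xE' : x = x - s (f x) by rewrite (Px : f x = 0) raddf0 subr0.
  have sfx : s (f x) = \sum_(p <- l) s (f (ract p.1 p.2)).
    by rewrite {1}xE raddf_sum /= raddf_sum.
  rewrite xE' sfx {1}xE -sumrB big_map; apply: eq_bigr => p _ /=.
  by rewrite ractDl ractNl !rhom_act.
pose d := @SubmodData R N (@ract R N) P (@ractA R N) (@ractDl R N) (@ractDr R N) P0 PB Pact Punit.
have jr : @is_rhom R (submod d) N (@smval R d).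
  by split=> // x y; exact: smvalB.
exists (submod d), (mk_rhom jr) => z.
have Pz : P (z - s (f z)) by rewrite /P raddfB /= fs subrr.
exists (f z, @mk_submod R d _ Pz); split; first by rewrite /= addrC subrK.
move=> [x y] /= zE.
have fz : f z = x by rewrite zE raddfD /= fs (smP y : f (smval y) = 0) addr0.
congr (_, _); first exact: fz.
by apply: smval_inj; rewrite /= fz zE addrAC subrr add0r.
Qed.

(** * Homomorphisms on the module of all step functions *)

Section TreeHom.
Context {R : rngType} {W : Type} {le : rel W} (hW : wo le).
Variable bot : W.
Hypothesis botP : forall w, le bot w.
Context {T : Type} {eqv : W -> T -> T -> Prop} (hT : tree le eqv).
Variables (A : chain_system R le) (M : rmodType R) (w : forall b, rhom (A b) M).
Hypothesis wa : forall b g (bg : le b g) x, w g (ch_map A bg x) = w b x.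
Local Notation amb A := (@amb R W le T A).
Local Notation is_step := (@is_step R W le T eqv _).
Local Notation adapted := (@adapted W le bot T eqv).
Local Notation stepQ := (@stepQ R W le T eqv _).

(** The module of all step functions on the tree. *)
Definition tree_all : rmodType R := tree_mod hW botP hT A (good_adapted hW bot hT).

(** The function that from level b on follows y along the branch x. *)
Definition nu_fun x b (y : A b) : amb A := fun z c =>
  match pselect (le b c) with
  | left bc => if `[< eqv c z x >] then ch_map A bc y else 0
  | right _ => 0
  end.

Lemma nu_funE x b (y : A b) z c (bc : le b c) : eqv c z x -> nu_fun x y z c = ch_map A bc y.
Proof.
move=> zx; rewrite /nu_fun; case: pselect => // bc'.
by rewrite asboolT// (bool_irrelevance bc bc').
Qed.

Lemma nu_fun_out x b (y : A b) z c : ~ (le b c /\ eqv c z x) -> nu_fun x y z c = 0.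
Proof.
move=> n; rewrite /nu_fun; case: pselect => // bc.
by rewrite asboolF// => zx; apply: n.
Qed.

Lemma nu_step x b (y : A b) : stepQ adapted (nu_fun x y).
Proof.
exists [set x], [set bot; b]; split.
  split.
  - exact: finite_set1.
  - exact: finite_set2.
  - by left.
  - by move=> _ _ c g -> -> _ _ []; exact: (tree_refl hT).
split.
- move=> c z z' zz'; have [bc|nbc] := pselect (le b c); last first.
    by rewrite !nu_fun_out// => -[].
  have [zx|nzx] := pselect (eqv c z x).
    rewrite !(nu_funE _ bc)//; exact: (tree_trans hT (tree_sym hT zz')).
  rewrite !nu_fun_out// => -[_ z'x]; apply: nzx => //; exact: (tree_trans hT zz').
- by move=> c z nz; rewrite nu_fun_out// => -[_]; exact: nz.
- move=> c d cd z [_ -> zx] sP; have zx' := tree_mono hT cd zx.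
  have [bd|nbd] := pselect (le b d).
    have bc : le b c by apply: sP => //; right.
    by rewrite (nu_funE _ bd)// (nu_funE _ bc)// (ch_map_comp _ _ bd).
  rewrite !nu_fun_out ?raddf0// => -[bc _]; apply: nbd => //; exact: (wo_trans hW bc).
Qed.

Lemma nu_is_rhom x b : is_rhom (fun y : A b =>
  mk_tree hW botP hT (good_adapted hW bot hT) (nu_step x y)).
Proof.
split=> [y z|y r]; apply: tree_fun_inj => u c; rewrite ?tree_funB.
  rewrite -[LHS]/(nu_fun x (y - z) u c) -[RHS]/(nu_fun x y u c - nu_fun x z u c).
  have [[bc ux]|n] := pselect (le b c /\ eqv c u x).
    by rewrite !(nu_funE _ bc)// raddfB.
  by rewrite !nu_fun_out// subrr.
rewrite -[LHS]/(nu_fun x (ract y r) u c) -[RHS]/(ract (nu_fun x y u c) r).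
have [[bc ux]|n] := pselect (le b c /\ eqv c u x).
  by rewrite !(nu_funE _ bc)// rhom_act.
by rewrite !nu_fun_out// ract0l.
Qed.

(** The homomorphism that sends y to the function following y along x from
    level b on. *)
Definition nu x b : rhom (A b) tree_all := mk_rhom (@nu_is_rhom x b).

Lemma nuE x b y : tree_fun (nu x b y) = nu_fun x y. Proof. by []. Qed.

(** The difference between following y from level a and following its image
    from level b depends only on the part of the branch below b. *)
Lemma nu_truncated x x' a b (ab : le a b) y :
  (forall c, ~~ le b c -> eqv c x x') ->
  nu x a y - nu x b (ch_map A ab y) = nu x' a y - nu x' b (ch_map A ab y).
Proof.
move=> xx'; apply: tree_fun_inj => z c; rewrite !tree_funB !nuE.
have trunc0 t : le b c -> nu_fun t y z c - nu_fun t (ch_map A ab y) z c = 0.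
  move=> bc; have ac := wo_trans hW ab bc.
  have [zt|nzt] := pselect (eqv c z t).
    by rewrite (nu_funE _ ac)// (nu_funE _ bc)// (ch_map_comp _ _ ac) subrr.
  by rewrite !nu_fun_out ?subrr// => -[].
case: (boolP (le b c)) => [bc|nbc]; first by rewrite !trunc0.
have xx'c := xx' c nbc; rewrite ![nu_fun _ (ch_map A ab y) _ _]nu_fun_out; last 2 first.
- by move=> [bc]; rewrite bc in nbc.
- by move=> [bc]; rewrite bc in nbc.
congr (_ - _); have [ac|nac] := pselect (le a c); last by rewrite !nu_fun_out// => -[].
have [zx|nzx] := pselect (eqv c z x).
  rewrite !(nu_funE _ ac)//; exact: (tree_trans hT zx).
rewrite !nu_fun_out// => -[_ zx']; apply: nzx => //.
exact: (tree_trans hT zx' (tree_sym hT xx'c)).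
Qed.

(** Along each branch a step function eventually defines one element of M. *)
Lemma evt_ex (f : tree_all) x :
  exists m, exists c, forall b, le c b -> w b (tree_fun f x b) = m.
Proof.
have [E [S [ad [f1 f2 f3]]]] := tree_funP f; have [_ Sfin S0 _] := ad.
have [[c nc]|/forallNP node] := pselect (exists c, ~ exists2 e, E e & eqv c x e).
  exists 0, c => b cb; rewrite f2 ?raddf0// => e Ee xe; apply: nc.
  by exists e => //; exact: (tree_mono hT cb).
have [m Sm mm] := finite_max hW Sfin (ex_intro _ bot S0).
exists (w m (tree_fun f x m)), m => b mb.
rewrite (f3 m b mb) ?wa//; last by move=> s Ss _; exact: mm.
exact: contrapT (node b).
Qed.

(** The eventual value of f along x. *)
Definition evt (f : tree_all) x : M := sval (cid (evt_ex f x)).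

Lemma evtE f x c m : (forall b, le c b -> w b (tree_fun f x b) = m) -> evt f x = m.
Proof.
move=> fm; have [d dE] := svalP (cid (evt_ex f x)).
have [b [cb db]] : exists b, le c b /\ le d b.
  by have [cd|dc] := wo_total hW c d; [exists d|exists c]; split=> //; exact: (wo_refl hW).
by rewrite -(fm b cb) (dE b db).
Qed.

Lemma evtP f x : exists c, forall b, le c b -> w b (tree_fun f x b) = evt f x.
Proof. exact: (svalP (cid (evt_ex f x))). Qed.

Lemma evtB f g x : evt (f - g) x = evt f x - evt g x.
Proof.
have [c cE] := evtP f x; have [d dE] := evtP g x.
have [cd|dc] := wo_total hW c d.
  apply: (@evtE _ _ d) => b db; rewrite tree_funB raddfB /= dE// cE//.
  exact: (wo_trans hW cd).
apply: (@evtE _ _ c) => b cb; rewrite tree_funB raddfB /= cE// dE//.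
exact: (wo_trans hW dc).
Qed.

Lemma evt_act f r x : evt (ract f r) x = ract (evt f x) r.
Proof.
have [c cE] := evtP f x; apply: (@evtE _ _ c) => b cb.
by rewrite tree_fun_act rhom_act cE.
Qed.

Lemma evt_supp f : exists s : seq {classic T}, uniq s /\
  forall x : {classic T}, x \notin s -> evt f x = 0.
Proof.
have [E [S [[Efin _ _ _] [f1 f2 f3]]]] := tree_funP f.
have [s Es] := finite_set_seq Efin; exists (undup s); rewrite undup_uniq; split=> // x.
rewrite mem_undup => xs.
have [c cE] : exists c, forall e, E e -> ~ eqv c x e.
  have : exists c, forall e : {classic T}, e \in s -> ~ eqv c x e.
    elim: s xs {Es} => [|e s IHs]; first by exists bot.
    rewrite inE negb_or => /andP[/eqP xe /IHs [c cE]].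
    have [d nd] := tree_sep hT xe.
    have [cd|dc] := wo_total hW c d.
      exists d => e'; rewrite inE => /orP[/eqP ->//|/cE n dE]; apply: n.
      exact: (tree_mono hT cd).
    exists c => e'; rewrite inE => /orP[/eqP -> cE'|/cE //]; apply: nd.
    exact: (tree_mono hT dc).
  by move=> [c h]; exists c => e /Es; exact: h.
apply: (@evtE _ _ c) => b cb; rewrite f2 ?raddf0// => e Ee xe; apply: (cE e Ee).
exact: (tree_mono hT cb).
Qed.

Lemma evt_nu x b y z : evt (nu x b y) z = if `[< z = x >] then w b y else 0.
Proof.
case: asboolP => [->|zx].
  apply: (@evtE _ _ b) => c bc; rewrite nuE (nu_funE _ bc) ?wa//.
  exact: (tree_refl hT).
have [d nd] := tree_sep hT zx; apply: (@evtE _ _ d) => c dc.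
rewrite nuE nu_fun_out ?raddf0// => -[_ zxc]; apply: nd; exact: (tree_mono hT dc).
Qed.

(** The homomorphism that adds up the eventual values along the branches
    selected by g. *)
Definition branch_sum_fun (g : T -> bool) (f : tree_all) : M :=
  \sum_(x \in [set: {classic T}]) (if g x then evt f x else 0).

Lemma branch_sum_is_rhom g : is_rhom (branch_sum_fun g).
Proof.
split=> [f f'|f r]; rewrite /branch_sum_fun.
  have [s [us sP]] := evt_supp f; have [s' [us' s'P]] := evt_supp f'.
  pose t := undup (s ++ s').
  have tf x : x \notin t -> evt f x = 0.
    by rewrite mem_undup mem_cat negb_or => /andP[/sP].
  have tf' x : x \notin t -> evt f' x = 0.
    by rewrite mem_undup mem_cat negb_or => /andP[_ /s'P].
  rewrite !(@fsum_list _ _ _ t) ?undup_uniq//.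
  - rewrite -sumrB; apply: eq_bigr => x _; case: (g x); rewrite ?subrr//.
    exact: evtB.
  - by move=> x xt; case: (g x) => //; exact: tf'.
  - by move=> x xt; case: (g x) => //; exact: tf.
  - by move=> x xt; case: (g x) => //; rewrite evtB tf// tf'// subrr.
have [s [us sP]] := evt_supp f.
rewrite !(@fsum_list _ _ _ s)//.
- rewrite ract_suml; apply: eq_bigr => x _; case: (g x); rewrite ?ract0l//.
  exact: evt_act.
- by move=> x xs; case: (g x) => //; exact: sP.
- by move=> x xs; case: (g x) => //; rewrite evt_act sP// ract0l.
Qed.

Definition branch_sum g : rhom tree_all M := mk_rhom (branch_sum_is_rhom g).

Lemma branch_sum_nu g x b y : branch_sum g (nu x b y) = if g x then w b y else 0.
Proof.
rewrite -[LHS]/(branch_sum_fun g (nu x b y)) /branch_sum_fun.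
rewrite (@fsum_list _ _ _ [:: (x : {classic T})])//.
  by rewrite big_seq1 evt_nu asboolT.
move=> z; rewrite inE => /eqP zx; rewrite evt_nu asboolF//; by case: (g z).
Qed.

(** If homomorphisms to M lift along f and branches code enough families with
    values in N, then f splits: there are more homomorphisms branch_sum g than
    restrictions of their lifts to the differences of nu_truncated. *)
Lemma lifting_splits (N : rmodType R) (f : rhom N M)
    (code : (W -> T -> {b : W & A b} -> N) -> T) :
  (forall c c', (forall b x y, (forall g, ~~ le b g -> eqv g x y) -> c b x = c b y) ->
    (forall b x y, (forall g, ~~ le b g -> eqv g x y) -> c' b x = c' b y) ->
    code c = code c' -> c = c') ->
  (forall y, exists b x, w b x = y) ->
  (forall b x, w b x = 0 -> exists g (bg : le b g), ch_map A bg x = 0) ->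
  (forall g : rhom tree_all M, exists h, rhom_comp f h = g) ->
  exists s : rhom M N, forall x, f (s x) = x.
Proof.
move=> codeI wsurj wker lift.
pose h g := sval (cid (lift (branch_sum g))).
have hE g x b y : f (h g (nu x b y)) = if g x then w b y else 0.
  have e : rhom_comp f (h g) = branch_sum g := svalP (cid (lift (branch_sum g))).
  by rewrite -branch_sum_nu -e.
(* The values of h g on the differences of nu_truncated, which branch_sum g
   kills, and 0 when the two levels are in the wrong order. *)
pose c g b x (p : {b : W & A b}) : N :=
  match pselect (le (projT1 p) b) with
  | left ab => h g (nu x _ (projT2 p) - nu x b (ch_map A ab (projT2 p)))
  | right _ => 0
  end.
have cinv g b x y : (forall g, ~~ le b g -> eqv g x y) -> c g b x = c g b y.
  move=> xy; apply/funext => p; rewrite /c; case: pselect => // ab.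
  by rewrite (nu_truncated ab _ xy).
have [g [g' [gg' cc']]] := cantor_pred (fun g => code (c g)).
have {}cc' : c g = c g' by apply: codeI => //; exact: cinv.
(* The maps h g and h g' agree on these differences, so that h g - h g' on the
   branch x factors through M. *)
have [x gx] : exists x, g x <> g' x.
  by apply: contrapT => /forallNP no; apply: gg'; apply/funext => x; exact: contrapT.
have [|s sE] := chain_induced hW bot wa wsurj wker (t := fun b => rhom_comp (h g - h g') (nu x b)).
  move=> a b ab y; have := congr1 (fun c => c b x (existT _ a y)) cc'.
  rewrite /c; case: pselect => //= ab' e.
  rewrite (bool_irrelevance ab' ab) in e.
  rewrite -[LHS]/(h g (nu x b (ch_map A ab y)) - h g' (nu x b (ch_map A ab y))).
  rewrite -[RHS]/(h g (nu x a y) - h g' (nu x a y)).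
  move: e; rewrite !raddfB /= => /eqP; rewrite subr_eq => /eqP ->.
  by rewrite addrAC [X in _ = X + _]addrAC subrr sub0r addrC.
have fsE b y : f (s (w b y)) = (if g x then w b y else 0) - (if g' x then w b y else 0).
  by rewrite sE -!hE -raddfB.
case: (g x) (g' x) gx fsE => [] [] // _ fsE.
  by exists s => m; have [b [y <-]] := wsurj m; rewrite fsE subr0.
exists (- s) => m; have [b [y <-]] := wsurj m.
by rewrite -[LHS]/(f (- s (w b y))) raddfN /= fsE sub0r opprK.
Qed.

End TreeHom.

(** * Separability of the module of all step functions *)

Section TreeSeparable.
Context {R : rngType} {W : Type} {le : rel W} (hW : wo le).
Variable bot : W.
Hypothesis botP : forall w, le bot w.
Context {T : Type} {eqv : W -> T -> T -> Prop} (hT : tree le eqv).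
Variables (D : direct_system R) (K : W -> set (ds_idx D)).
Hypothesis Kmono : forall b g, le b g -> K b `<=` K g.
Hypothesis K0 : forall b, K b !=set0.
Hypothesis Kdir : forall b i j, K b i -> K b j ->
  exists k, [/\ K b k, (i <= k)%O & (j <= k)%O].
Variables (A : chain_system R le) (v : forall b i, K b i -> rhom (D i) (A b)).
Hypothesis vmap : forall b g (bg : le b g) i (bi : K b i) (gi : K g i) x,
  ch_map A bg (v bi x) = v gi x.
Hypothesis vtrans : forall b i j (bi : K b i) (bj : K b j) (ij : (i <= j)%O) x,
  v bj (ds_map ij x) = v bi x.
Hypothesis vsurj : forall b y, exists i (bi : K b i) x, v bi x = y.
Hypothesis vker : forall b i (bi : K b i) x, v bi x = 0 ->
  exists j (ij : (i <= j)%O), K b j /\ ds_map ij x = 0.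
Variable F : rmodType R -> Prop.
Hypothesis Fsum : closed_finite_sums F.
Hypothesis DF : forall i, F (D i).

Lemma tree_all_lim : lim_class F (tree_all hW botP hT A).
Proof.
exists (tree_system hW botP hT Kmono K0 Kdir (good_adapted hW bot hT)); split.
  exact: tree_system_in.
by eexists; exact: tree_limit.
Qed.

(** The summands are the modules of step functions over single pairs. *)
Lemma tree_all_separable theta : emb nat theta ->
  (forall b, small theta {i | K b i}) ->
  (forall M, F M -> finitely_presented M) ->
  separable theta (tree_all hW botP hT A).
Proof.
move=> theta_inf Ksmall Ffp.
pose Z E S : set (tree_all hW botP hT A) :=
  fun f => is_step (eqv := eqv) E S (tree_fun f).
exists [set X | exists E S, adapted (le := le) bot (eqv := eqv) E S /\ X = Z E S].
split.
- have [E [S ad]] := good_ne (good_adapted hW bot hT).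
  by exists (Z E S), E, S.
- move=> _ _ [E [S [ad ->]]] [E' [S' [ad' ->]]].
  have [E'' [S'' [ad'' [EE EE'] [SS SS']]]] := good_dir (good_adapted hW bot hT) ad ad'.
  exists (Z E'' S''); first by exists E'', S''.
  by move=> f [] fS; [exact: (is_step_mono hT ad'' EE SS fS)
                     |exact: (is_step_mono hT ad'' EE' SS' fS)].
- apply/seteqP; split=> // f _; have [E [S [ad fS]]] := tree_funP f.
  by exists (Z E S) => //; exists E, S.
- move=> _ [E [S [ad ->]]].
  have [i [iE isum]] := tree_mod_summand hW botP hT A (good_adapted hW bot hT) ad ad.
  exists (tree_mod hW botP hT A (good_single ad)), i; split=> //.
    exists (tree_system hW botP hT Kmono K0 Kdir (good_single ad)); split.
    + have [sm1 sm2] := tree_idx_small hW botP Kmono ad theta_inf Ksmall.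
      by split; rewrite card_le_emb.
    + by move=> p; apply: Ffp; exact: tree_system_in.
    + by eexists; exact: tree_limit.
  apply/seteqP; split=> [f fS|_ [f _ <-]].
    have fQ : stepQ (eqv := eqv) (single E S) (tree_fun f) by exists E, S.
    exists (mk_tree hW botP hT (good_single ad) fQ) => //.
    by apply: smval_inj; exact: (iE (mk_tree hW botP hT (good_single ad) fQ)).
  by rewrite /Z iE; have [E' [S' [[-> ->]]]] := tree_funP f.
Qed.

End TreeSeparable.

Theorem corollary4p3 (R : rngType) (B F : rmodType R -> Prop) (theta : Type) :
  enough_idempotents R ->
  precovering B ->
  closed_summands B ->
  (forall M, F M -> finitely_presented M) ->
  closed_finite_sums F ->
  (exists G, B G /\ is_generator G) ->
  ~ finite_set [set: theta]%classic ->
  (forall M, separable theta M -> lim_class F M -> B M) ->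
  forall M, presented theta M -> lim_class F M -> B M.
Proof.
move=> _ precov Bsum Ffp Fsum _ /infiniteP/card_le_emb theta_inf sepB M Mpres Mlim.
have [D [u [W [le [K [[DF hW [w0 _] Kmono Kb] [ua usurj uker]]]]]]] :=
  presented_chain theta_inf Ffp Mpres Mlim.
have K0 b : K b !=set0 by have [] := Kb b.
have Kdir b i j : K b i -> K b j -> exists k, [/\ K b k, (i <= k)%O & (j <= k)%O].
  by have [_ + _] := Kb b; exact.
have Ksmall b : small theta {i | K b i} by have [] := Kb b.
have [A [v [w [vmap vtrans vsurj vker wv]]]] := chain_colim ua Kmono K0 Kdir.
have wa b g (bg : le b g) x : w g (ch_map A bg x) = w b x.
  have [i [bi [y <-]]] := vsurj b x.
  by rewrite (vmap _ _ bg _ bi (Kmono _ _ bg _ bi)) !wv.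
have wsurj y : exists b x, w b x = y.
  have [b [i [x [bi <-]]]] := usurj y.
  by exists b, (v b i bi x); rewrite wv.
have wker b x : w b x = 0 -> exists g (bg : le b g), ch_map A bg x = 0.
  have [i [bi [y <-]]] := vsurj b x.
  rewrite wv => uy0; have [b' [j [ij [b'j yj]]]] := uker b i y bi uy0.
  have [g [bg b'g]] : exists g, le b g /\ le b' g.
    by have [bb'|b'b] := wo_total hW b b'; [exists b'|exists b]; split=> //; exact: (wo_refl hW).
  exists g, bg; rewrite (vmap _ _ bg _ bi (Kmono _ _ bg _ bi)).
  by rewrite -(vtrans _ _ _ _ (Kmono _ _ b'g _ b'j) ij) yj raddf0.
have [bot _ bot_min] := wo_min hW (ex_intro (fun=> True) w0 I).
have botP b : le bot b by exact: bot_min.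
have [N [f [BN fcov]]] := precov M.
have [T [eqv [code [hT codeI]]]] := exists_coding_tree hW {b : W & A b} (0 : N).
have BL : B (tree_all hW botP hT A).
  apply: sepB; first exact: (tree_all_separable hW botP hT Kmono K0 Kdir vmap
    vtrans vsurj vker Fsum DF theta_inf Ksmall Ffp).
  exact: (tree_all_lim hW botP hT Kmono K0 Kdir vmap vtrans vsurj vker Fsum DF).
have [s fs] := lifting_splits (hW := hW) (botP := botP) (hT := hT) wa codeI wsurj wker (fcov _ BL).
exact: Bsum BN (retract_summand fs).
Qed.
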